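(* Let $V$ be a vector space over the two-element field $\mathbb{F}_2$ of finite positive dimension, endowed with a (possibly degenerate) symplectic form $B$. Assume that $S$ is a linearly independent set of $V$ and no element of $S$ is in the radical ${\rm rad}\,V$. Then the group $Tv(S)$ is isomorphic to a symmetric group if and only if the graph $G(S)$ is a claw-free block graph.
   Context: A symplectic form on $V$ is a bilinear form $B:V\times V\to\mathbb{F}_2$ with $B(\alpha,\alpha)=0$ for all $\alpha\in V$; it is not assumed nondegenerate. The radical is ${\rm rad}\,V=\{\alpha\in V: B(\alpha,\beta)=0 \text{ for all }\beta\in V\}$. For $\alpha\in V$ the transvection $\tau_\alpha:V\to V$ with direction $\alpha$ is the linear map $\tau_\alpha\beta=\beta+B(\beta,\alpha)\alpha$ for $\beta\in V$; one has $\tau_\alpha^2=1$ and $\tau_\alpha\in{\rm SL}(V)$. For a subset $S\subseteq V$, $Tv(S)$ is the subgroup of the special linear group ${\rm SL}(V)$ generated by $\{\tau_\alpha:\alpha\in S\}$, and $G(S)$ is the simple graph with vertex set $S$ in which $\alpha,\beta\in S$ are adjacent if and only if $B(\alpha,\beta)=1$. A cut-vertex of a simple graph is a vertex whose deletion increases the number of connected components. A block of a graph $G$ is a maximal connected subgraph of $G$ that has no cut-vertex (of its own). A block graph is a simple connected graph in which every block is a complete graph. A claw is a tree with one internal vertex and three leaves; a simple graph is claw-free if it does not contain a claw as an induced subgraph. *)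

(* Defs.v *)
From HB Require Import structures.
From mathcomp Require Import all_boot all_order all_algebra all_fingroup.
From mathcomp Require Import all_solvable all_field.

Set Implicit Arguments.
Unset Strict Implicit.
Unset Printing Implicit Defensive.

Import GRing.Theory.
Local Open Scope ring_scope.

(* A finite simple graph on a subset of an ambient finite type, so that a     *)
(* subgraph (not necessarily induced) has the same type as the whole graph.   *)
Record sgraph (T : finType) := SGraph {
  verts : {set T};
  adj : rel T;
  adj_sym : symmetric adj;
  adj_irr : irreflexive adj;
  adj_verts : forall x y, adj x y -> x \in verts
}.

Section Graphs.
Variable T : finType.
Implicit Types (G H K : sgraph T) (x y : T).

Lemma adj_verts_r G x y : adj G x y -> y \in verts G.
Proof. by rewrite adj_sym; apply: adj_verts. Qed.

Definition subgraph H G : Prop :=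
  verts H \subset verts G /\ subrel (adj H) (adj G).

Section Delete.
Variables (G : sgraph T) (v : T).

Definition del_adj : rel T := [rel x y | [&& x != v, y != v & adj G x y]].

Lemma del_adj_sym : symmetric del_adj.
Proof. by move=> x y; rewrite /del_adj /= andbCA adj_sym. Qed.

Lemma del_adj_irr : irreflexive del_adj.
Proof. by move=> x; rewrite /del_adj /= adj_irr !andbF. Qed.

Lemma del_adj_verts x y : del_adj x y -> x \in verts G :\ v.
Proof. by case/and3P=> xv _ /adj_verts xG; rewrite !inE xv. Qed.

Definition del_vertex : sgraph T :=
  SGraph del_adj_sym del_adj_irr del_adj_verts.

End Delete.

Definition num_components G : nat := n_comp (adj G) (verts G).

(* The empty graph is connected for this definition. *)
Definition connected G : Prop :=
  {in verts G &, forall x y, connect (adj G) x y}.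

Definition cut_vertex G x : Prop :=
  x \in verts G /\ (num_components G < num_components (del_vertex G x))%N.

Definition nonseparable G : Prop :=
  connected G /\ forall x, ~ cut_vertex G x.

Definition block G H : Prop :=
  [/\ subgraph H G, nonseparable H &
      forall K, subgraph K G -> nonseparable K -> subgraph H K ->
                subgraph K H].

Definition complete G : Prop :=
  {in verts G &, forall x y, x != y -> adj G x y}.

Definition block_graph G : Prop :=
  connected G /\ forall H, block G H -> complete H.

End Graphs.

(* The graph G contains a copy of H as an induced subgraph. *)
Definition induced_in (U T : finType) (H : sgraph U) (G : sgraph T) : Prop :=
  exists f : U -> T,
    [/\ {in verts H &, injective f},
        {in verts H, forall u, f u \in verts G} &
        {in verts H &, forall u v, adj G (f u) (f v) = adj H u v}].

(* The internal vertex is 0, the leaves are 1, 2 and 3. *)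
Definition claw_adj : rel 'I_4 :=
  [rel i j | (i != j) && ((i == ord0) || (j == ord0))].

Lemma claw_adj_sym : symmetric claw_adj.
Proof. by move=> i j; rewrite /claw_adj /= eq_sym orbC. Qed.

Lemma claw_adj_irr : irreflexive claw_adj.
Proof. by move=> i; rewrite /claw_adj /= eqxx. Qed.

Lemma claw_adj_verts i j : claw_adj i j -> i \in [set: 'I_4].
Proof. by rewrite inE. Qed.

Definition claw : sgraph 'I_4 :=
  SGraph claw_adj_sym claw_adj_irr claw_adj_verts.

Definition claw_free (T : finType) (G : sgraph T) : Prop := ~ induced_in claw G.

(* Nondegeneracy is not required, unlike in the library's is_psymplectic. *)
Record symplectic_form (V : vectType 'F_2) := SymplecticForm {
  form_of :> {biscalar V};
  form_alt : forall a, form_of a a = 0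
}.

Section SpecialLinear.
Variable V : vectType 'F_2.
Local Notation fV := (finvect_type V).
Implicit Types s t : {perm fV}.

Definition perm_det s : 'F_2 :=
  \det (passmx.mxof (vbasis {:fV}) (vbasis {:fV}) (linfun s)).

(* SL(V), as a group of permutations of the finite set of vectors of V. *)
Definition SL_set : {set {perm fV}} :=
  [set s : {perm fV} |
    [forall a : 'F_2, [forall x : fV, [forall y : fV,
       s (a *: x + y) == a *: s x + s y]]] && (perm_det s == 1)].

Lemma SL_setP s : reflect (linear s /\ perm_det s = 1) (s \in SL_set).
Proof.
rewrite inE; apply: (iffP andP) => -[lin_s /eqP det_s].
  split=> // a x y; apply/eqP.
  by move: lin_s => /forallP/(_ a)/forallP/(_ x)/forallP/(_ y).
split=> //.
by apply/forallP=> a; apply/forallP=> x; apply/forallP=> y; apply/eqP/lin_s.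
Qed.

Lemma linear_linfunE (f : fV -> fV) : linear f -> linfun f =1 f.
Proof.
move=> lin_f; pose h := GRing.isSemilinear.Build _ _ _ _ f
  (GRing.semilinear_linear lin_f).
pose g : {linear fV -> fV} := HB.pack f h.
by move=> x; rewrite (lfunE g).
Qed.

Lemma perm_detM s t :
  linear s -> linear t -> perm_det (s * t)%g = perm_det s * perm_det t.
Proof.
move=> lin_s lin_t; have lin_st: linear (s * t)%g.
  by move=> a x y; rewrite !permM lin_s lin_t.
rewrite /perm_det -det_mulmx -passmx.mxof_comp ?vbasisP //.
congr (\det (passmx.mxof _ _ _)); apply/lfunP=> x.
by rewrite comp_lfunE !linear_linfunE // permM.
Qed.

Lemma perm_det1 : perm_det 1%g = 1.
Proof.
rewrite /perm_det -[RHS](det1 _ (\dim {:fV})).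
rewrite -(passmx.mxof1 (basis_free (vbasisP {:fV}))).
congr (\det (passmx.mxof _ _ _)); apply/lfunP=> x.
by rewrite id_lfunE linear_linfunE ?perm1 // => a u v; rewrite !perm1.
Qed.

Lemma SL_group_set : group_set SL_set.
Proof.
apply/group_setP; split=> [|s t /SL_setP[lin_s det_s] /SL_setP[lin_t det_t]].
  by apply/SL_setP; split; [move=> a x y; rewrite !perm1 | exact: perm_det1].
apply/SL_setP; split; first by move=> a x y; rewrite !permM lin_s lin_t.
by rewrite perm_detM // det_s det_t mulr1.
Qed.

Canonical SL := Group SL_group_set.

End SpecialLinear.

Section Transvections.
Variables (V : vectType 'F_2) (B : symplectic_form V).
Local Notation fV := (finvect_type V).
Implicit Types (a b : fV) (S : {set fV}).

Definition radical : {set fV} := [set a : fV | [forall b : fV, B a b == 0]].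

Lemma form_sym a b : B a b = B b a.
Proof.
have := form_alt B (a + b).
rewrite linearDl !linearDr /= !form_alt add0r addr0 => /eqP.
by rewrite addr_eq0 => /eqP->; rewrite (oppr_pchar2 (pchar_Fp (isT : prime 2))).
Qed.

Definition transv_fun a b : fV := b + B b a *: (a : V).

Lemma transv_funK a : involutive (transv_fun a).
Proof.
move=> b; rewrite /transv_fun linearDl linearZl_LR /= form_alt mulr0 addr0.
rewrite -addrA -scalerDl (addrr_pchar2 (pchar_Fp (isT : prime 2))).
by rewrite scale0r addr0.
Qed.

Definition transv a : {perm fV} := perm (can_inj (transv_funK a)).

Lemma transv_SL a : transv a \in SL V.
Proof.
have lin_a: linear (transv a).
  move=> c x y; rewrite !permE /transv_fun linearDl linearZl_LR /=.
  by rewrite scalerDl scalerDr scalerA addrACA.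
apply/SL_setP; split=> //.
have: perm_det (transv a) * perm_det (transv a) = 1.
  rewrite -perm_detM // (_ : _ * _ = 1)%g ?perm_det1 //.
  by apply/permP=> x; rewrite permM !permE transv_funK.
by case: (perm_det _) => [[|[|m]] ltm2] // _; apply/val_inj.
Qed.

(* Generation in the group of all permutations of V agrees with generation in *)
(* SL(V): see Tv_sub_SL.                                                      *)
Definition Tv S : {group {perm fV}} := <<[set transv a | a in S]>>%G.

Lemma Tv_sub_SL S : Tv S \subset SL V.
Proof. by rewrite gen_subG; apply/subsetP=> _ /imsetP[a _ ->]; apply: transv_SL. Qed.

Section FormGraph.
Variable S : {set fV}.

Definition form_adj : rel fV := [rel a b | [&& a \in S, b \in S & B a b == 1]].

Lemma form_adj_sym : symmetric form_adj.
Proof. by move=> a b; rewrite /form_adj /= andbCA form_sym. Qed.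

Lemma form_adj_irr : irreflexive form_adj.
Proof. by move=> a; rewrite /form_adj /= form_alt !andbF. Qed.

Lemma form_adj_verts a b : form_adj a b -> a \in S.
Proof. by case/and3P. Qed.

Definition form_graph : sgraph fV :=
  SGraph form_adj_sym form_adj_irr form_adj_verts.

End FormGraph.

End Transvections.

(* Main.v *)
(* A connected claw-free block graph is the line graph of a tree. Growing the *)
(* tree edge by edge produces vectors [w_i] (its vertices, one of them being  *)
(* [0]) such that the elements of [S] are the sums [w_i + w_j] over the edges,*)
(* and such that [B] is the dot product of even subsets of the vertices; the  *)
(* action [v |-> v + \sum_i B(v, w_i) (w_(s i) + w_i)] of the permutations    *)
(* [s] is then faithful, and a transposition [(i j)] acts as the transvection *)
(* with direction [w_i + w_j].                                                *)
(* Conversely, a product of two transvections has order at most 3. In a       *)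
(* symmetric group, an involution [t] such that every product [t * t ^ g] has *)
(* order at most 3 is a transposition, or is fixed point free of degree 4 or  *)
(* 6. Degree 4 is excluded because such involutions commute, and in degree 6  *)
(* the outer automorphism makes them transpositions again. Hence [G(S)] is an *)
(* induced subgraph of the line graph of a complete graph, so it has no claw; *)
(* a cycle of [G(S)] violating the block graph condition would express an     *)
(* element of [S] as a linear combination of the others.                      *)
Require Import Defs.
From mathcomp Require Import all_boot all_order all_algebra all_fingroup.
From mathcomp Require Import all_solvable all_field.

Set Implicit Arguments.
Unset Strict Implicit.
Unset Printing Implicit Defensive.


(** * Block graphs and cycles *)

(** For a connected graph, being a block graph amounts to [cycle_closed]: two neighbours of [a]
    joined by a path avoiding [a] are adjacent ([block_graph_cycle_closed],
    [cycle_closed_block_graph]). Both directions work with this condition.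

    From the graph to the group: [exists_tree_points] realizes [G(S)] as the line graph of a tree
    whose vertices are vectors, adding one leaf at a time. On sums of two points the form is a dot
    product modulo 2 ([tree_dot]), and linear independence makes such a sum determine its ends
    ([tree_uniq_ends]). Hence the permutations of the points act faithfully on [V]
    ([point_perm_inj]), transpositions acting as transvections ([point_perm_tperm]). The edges of a
    tree generate all transpositions, so the image is [Tv S] ([tree_points_isog]).

    From the group to the graph: products of two transvections have order at most 3
    ([transv_mul_order]), which leaves few possibilities for the image of a generator
    ([short_products_cases]). Degree 4 is excluded by [image_transv_not4]; in the other cases the
    generators are labelled by pairs of points, two of them being adjacent exactly when their pairs
    share one point. Claw-freeness follows at once. A path avoiding [a] between neighbours meeting
    [a] at different points would put [a] in the span of the other generators ([path_label]).
    Connectedness holds because distinct labelled elements have noncommuting conjugates, whereas all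
    conjugates of transvections from different components commute. *)

Section BlockGraphs.
Variable T : finType.
Implicit Types (G H K : sgraph T) (x y z : T) (X : {set T}) (s : seq T).

Lemma connect_adj_sym G : connect_sym (adj G).
Proof. exact/sym_connect_sym/adj_sym. Qed.

Lemma connect_verts G x y :
  connect (adj G) x y -> (x \in verts G) = (y \in verts G).
Proof.
apply: closed_connect => u v uv.
by rewrite (adj_verts uv) (adj_verts_r uv).
Qed.

Lemma connected_num_components G : connected G <-> (num_components G <= 1)%N.
Proof.
have sG := connect_adj_sym G.
rewrite /num_components; split=> [cG | /card_le1_eqP le1 x y xG yG].
  apply/card_le1_eqP => x y /andP[/eqP rx xG] /andP[/eqP ry yG].
  by rewrite -rx -ry; apply/(fingraph.rootP sG)/cG.
by apply/(fingraph.rootP sG)/le1; rewrite inE /= roots_root //=;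
  rewrite -(connect_verts (connect_root _ _)).
Qed.

Lemma num_components_gt0 G x : x \in verts G -> (0 < num_components G)%N.
Proof.
move=> xG; rewrite /num_components; apply/card_gt0P.
exists (fingraph.root (adj G) x).
rewrite inE /= roots_root; last exact: connect_adj_sym.
by rewrite -(connect_verts (connect_root _ x)).
Qed.

(** A connected graph with a vertex has exactly one component, so its cut-vertices are those whose
    deletion leaves at least two. *)
Lemma nonseparableP G :
  nonseparable G <->
  connected G /\ {in verts G, forall x, connected (del_vertex G x)}.
Proof.
split=> -[cG cutG]; split=> // x.
  move=> xG; apply/connected_num_components; rewrite leqNgt; apply/negP => gt1.
  apply: (cutG x); split=> //; apply: leq_ltn_trans gt1.
  exact/connected_num_components.
case=> xG; apply/negP; rewrite -leqNgt.
apply: leq_trans (num_components_gt0 xG).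
exact/connected_num_components/cutG.
Qed.

Section Induced.
Variables (G : sgraph T) (X : {set T}).

Definition ind_adj : rel T := [rel x y | [&& x \in X, y \in X & adj G x y]].

Lemma ind_adj_sym : symmetric ind_adj.
Proof. by move=> x y; rewrite /ind_adj /= andbCA adj_sym. Qed.

Lemma ind_adj_irr : irreflexive ind_adj.
Proof. by move=> x; rewrite /ind_adj /= adj_irr !andbF. Qed.

Lemma ind_adj_verts x y : ind_adj x y -> x \in X :&: verts G.
Proof. by case/and3P=> xX _ /adj_verts xG; rewrite inE xX. Qed.

Definition induced : sgraph T := SGraph ind_adj_sym ind_adj_irr ind_adj_verts.

End Induced.

Lemma induced_sub G X : subgraph (induced G X) G.
Proof. by split=> [|x y /and3P[]//]; apply: subsetIr. Qed.

Lemma sorted_connect (e r : rel T) s :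
    sorted e s -> {in s &, subrel e r} -> connect_sym r ->
  {in s &, forall x y, connect r x y}.
Proof.
move=> se sub sym; case: s se sub => // z s se sub.
suff zs x : x \in z :: s -> connect r z x.
  by move=> x y /zs zx /zs; apply: connect_trans; rewrite sym.
elim: s z se sub x => [|t s IHs] z /= se sub x.
  by rewrite inE => /eqP->.
case/andP: se => zt ts; rewrite inE => /predU1P[-> // | xs].
apply: (@connect_trans _ _ t).
  by apply/connect1/sub; rewrite ?inE ?eqxx ?orbT.
apply: IHs => // u v us vs; apply: sub; rewrite inE ?us ?vs orbT //.
Qed.

(* Together with connectedness, this characterizes block graphs.              *)
Definition cycle_closed G : Prop := forall a b c,
  adj G a b -> adj G a c -> b != c -> connect (del_adj G a) b c -> adj G b c.

(** Deleting [a] leaves a path; deleting another vertex cuts this path into two pieces, each still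
    attached to [a] through [b] or through the last vertex. *)
Lemma cycle_nonseparable G a b s :
    path (del_adj G a) b s -> uniq (b :: s) -> adj G a b ->
    adj G a (last b s) ->
  nonseparable (induced G [set x in a :: b :: s]).
Proof.
move=> bs uniqs ab ac; set X := [set x in _]; set H := induced G X.
have symH v := connect_adj_sym (del_vertex H v).
have aG : a \in verts G := adj_verts ab.
have sa x : x \in b :: s -> x != a.
  rewrite inE => /predU1P[-> | xs].
    by rewrite eq_sym; apply: contraTneq ab => ->; rewrite adj_irr.
  have/pathP: path (del_adj G a) b s := bs.
  move=> /(_ b (index x s)); rewrite index_mem nth_index // => /(_ xs).
  by case/and3P.
have aX : a \in X by rewrite !inE eqxx.
have sX x : x \in b :: s -> x \in X by move=> xs; rewrite inE inE xs orbT.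
have vertsH x : x \in verts H -> (x == a) || (x \in b :: s).
  by rewrite inE => /andP[]; rewrite inE inE.
have con_s v s' : sorted (del_adj G a) s' -> {subset s' <= b :: s} ->
    v \notin s' -> {in s' &, forall x y, connect (adj (del_vertex H v)) x y}.
  move=> ss' sub nv; apply: (sorted_connect ss') => // x y xs' ys'.
  case/and3P=> xa ya xy; apply/and4P; split.
  - by apply: contraNneq nv => <-.
  - by apply: contraNneq nv => <-.
  - exact/sX/sub.
  - by rewrite /= xy andbT; apply/sX/sub.
have con_del v : v \in verts H -> connected (del_vertex H v).
  move=> /vertsH; case: eqVneq => [-> _ | va /= vs].
    move=> x y; rewrite !inE => /andP[xa /andP[]].
    rewrite (negPf xa) /= => xs _ /andP[ya /andP[]].
    rewrite (negPf ya) /= => ys _; apply: (con_s a (b :: s)) => //.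
    by apply/negP => /sa; rewrite eqxx.
  suff toa x : x \in b :: s -> x != v -> connect (adj (del_vertex H v)) x a.
    have toa' x : x \in verts (del_vertex H v) ->
        connect (adj (del_vertex H v)) x a.
      rewrite inE in_set1 => /andP[xv /vertsH/predU1P[-> //|xs]]; exact: toa.
    by move=> x y /toa' xa /toa'; rewrite symH; apply: connect_trans.
  move=> xs xv.
  have step y : y \in b :: s -> y != v -> adj G a y ->
      connect (adj (del_vertex H v)) y a.
    move=> ys yv ay; apply/connect1/and4P; split=> //.
    - by rewrite eq_sym.
    - exact: sX.
    - by rewrite adj_sym ay aX.
  have [s1 [s2 eq_s]] : exists s1 s2, b :: s = s1 ++ v :: s2.
    by case/splitPr: vs => s1 s2; exists s1, s2.
  have srt : sorted (del_adj G a) (b :: s) by [].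
  have := uniqs; rewrite eq_s cat_uniq => /and3P[_ nv1 /andP[nv2 _]].
  have {}nv1 : v \notin s1.
    by apply: contra nv1 => v1; apply/hasP; exists v; rewrite ?mem_head.
  have [srt1 srt2] : sorted (del_adj G a) s1 /\ sorted (del_adj G a) s2.
    move: srt; rewrite eq_s; case: (s1) => [|z s1'] /=; first by move/path_sorted.
    by rewrite cat_path /= => /and3P[-> _ /path_sorted].
  have sub1 : {subset s1 <= b :: s} by move=> z z1; rewrite eq_s mem_cat z1.
  have sub2 : {subset s2 <= b :: s}.
    by move=> z z2; rewrite eq_s mem_cat inE z2 !orbT.
  have := xs; rewrite eq_s mem_cat inE (negPf xv) /= => /orP[x1 | x2].
    have b1 : b \in s1.
      by case: (s1) x1 eq_s => // z s1' _ [-> _]; rewrite mem_head.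
    apply: connect_trans (con_s v s1 srt1 sub1 nv1 _ _ x1 b1) _.
    by apply: step; rewrite ?mem_head //; apply: contraNneq nv1 => <-.
  have l2 : last b s \in s2.
    case: (s2) x2 eq_s => // z s2' _ eq_s.
    rewrite -[last b s]/(last b (b :: s)) eq_s last_cat /=.
    by rewrite mem_last.
  apply: connect_trans (con_s v s2 srt2 sub2 nv2 _ _ x2 l2) _.
  by apply: step; rewrite ?mem_last //; apply: contraNneq nv2 => <-.
apply/nonseparableP; split=> //.
have bH : b \in verts H by rewrite !inE eqxx orbT /= (adj_verts_r ab).
have sub_del v : subrel (connect (adj (del_vertex H v))) (connect (adj H)).
  by apply: connect_sub => x y /and3P[_ _ xy]; apply: connect1.
suff tob x : x \in verts H -> connect (adj H) x b.
  move=> x y /tob xb /tob; rewrite (connect_adj_sym H).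
  exact: connect_trans.
move=> xH; have := xH => /vertsH/predU1P[-> | xs].
  by apply/connect1/and3P; split=> //; apply/sX/mem_head.
have aH : a \in verts H by rewrite !inE eqxx.
apply/(sub_del a)/(con_del a) => //; rewrite !inE; apply/andP; split.
- exact: sa.
- by move: xH; rewrite !inE.
- by rewrite sa ?mem_head.
- by rewrite eqxx orbT (adj_verts_r ab).
Qed.

(* The sum of the numbers of vertices and (oriented) edges is bounded, hence  *)
(* a nonseparable subgraph extends to a block.                                *)
Lemma block_graph_cycle_closed G : block_graph G -> cycle_closed G.
Proof.
move=> [_ blockG] a b c ab ac bc /connectP[p0 p0b c_last].
case/shortenP: p0b c_last => p pb uniqp _ c_last; rewrite {}c_last in ac bc *.
have:= cycle_nonseparable pb uniqp ab ac; set H := induced _ _ => nonsepH.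
have bH : b \in verts H by rewrite !inE eqxx orbT (adj_verts_r ab).
have cH : last b p \in verts H.
  by rewrite inE (adj_verts_r ac) inE inE mem_last orbT.
have subH : subgraph H G := induced_sub _ _.
(* The cycle is generalized to any nonseparable subgraph containing both ends. If these are not
   adjacent, the induction hypothesis excludes every larger nonseparable subgraph, so [H] is a
   block, hence complete. *)
move: H subH nonsepH bH cH {pb uniqp ac ab} => H.
pose E H := [set xy : T * T | adj H xy.1 xy.2].
pose mu H := #|verts H| + #|E H|.
have [k] := ubnP (#|T| + #|{: T * T}| - mu H).
elim: k H => // k IHk H ltk subH nonsepH bH cH.
case: (boolP (adj G b (last b p))) => // nadj.
have blockH : block G H.
  split=> // K subK nonsepK HK.
  have EHK : E H \subset E K.
    by apply/subsetP => xy; rewrite !inE; apply: HK.2.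
  have [subV | ] := boolP (verts K \subset verts H).
    have [subE | subE] := boolP (E K \subset E H).
      split=> // x y xy; have /(subsetP subE) : (x, y) \in E K by rewrite inE.
      by rewrite inE.
    case/negP: nadj; apply: (IHk K) => //; [|exact: (subsetP HK.1)..].
    have muHK : (mu H < mu K)%N.
      by rewrite -addnS leq_add ?subset_leq_card ?HK.1 // proper_card // properE EHK.
    have muK : (mu K <= #|T| + #|{: T * T}|)%N by rewrite leq_add ?max_card.
    by rewrite -ltnS (leq_trans _ ltk) // ltnS ltn_sub2l // (leq_trans muHK).
  move=> subV; case/negP: nadj; apply: (IHk K) => //; [|exact: (subsetP HK.1)..].
  have muHK : (mu H < mu K)%N.
    by rewrite -addSn leq_add ?subset_leq_card // proper_card // properE HK.1.
  have muK : (mu K <= #|T| + #|{: T * T}|)%N by rewrite leq_add ?max_card.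
  by rewrite -ltnS (leq_trans _ ltk) // ltnS ltn_sub2l // (leq_trans muHK).
by rewrite -(negPf nadj); apply/subH.2/(blockG H blockH).
Qed.

(** A path in a block is shortened one vertex at a time: if [x] is adjacent to [l] and [l] to [z],
    nonseparability joins [x] and [z] outside [l], and the cycle condition makes them adjacent. *)
Lemma cycle_closed_block_graph G :
  connected G -> cycle_closed G -> block_graph G.
Proof.
move=> cG ccG; split=> // H [subH nonsepH maxH].
have /nonseparableP[cH cdH] := nonsepH.
have symH := connect_adj_sym H.
have adjG x y : x \in verts H -> y \in verts H -> x != y -> adj G x y.
  move=> xH yH; case/connectP: (cH x y xH yH) => p; elim/last_ind: p y yH.
    by move=> y _ _ /= -> /eqP.
  move=> p z IHp y yH; rewrite rcons_path last_rcons => /andP[xp lz] eq_yz.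
  rewrite {}eq_yz {y} in yH *; move=> xz.
  have [<- | xl] := eqVneq (last x p) x; first exact/subH.2.
  have lH := adj_verts lz.
  apply: (ccG (last x p)) => //; last 1 first.
  - have: connect (adj (del_vertex H (last x p))) x z.
      apply: cdH; rewrite ?inE ?xH ?yH ?andbT // 1?eq_sym //.
      by apply: contraTneq lz => ->; rewrite adj_irr.
    apply: connect_sub => u v /and3P[ul vl uv]; apply/connect1/and3P.
    by split=> //; apply: subH.2.
  - by rewrite adj_sym; apply: (IHp _ lH xp) => //; rewrite eq_sym.
  - exact/subH.2.
move=> x y xH yH xy.
(* Adjacency is known in [G] only, and [H] is not given as an induced subgraph; maximality against
   [K] brings the edges into [H]. *)
pose K := induced G (verts H).
have vK : verts K = verts H by apply/setIidPl; apply: subH.1.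
have HK : subrel (adj H) (adj K).
  move=> u v uv; apply/and3P; split; [exact: adj_verts uv|..|exact/subH.2].
  exact: adj_verts_r uv.
have nonsepK : nonseparable K.
  apply/nonseparableP; split=> [u v | z].
    rewrite vK => uH vH; have := cH u v uH vH.
    by apply: connect_sub => s t st; apply/connect1/HK.
  rewrite vK => zH u v; rewrite !inE -!in_setI !(setIidPl subH.1) => uz vz.
  have: connect (adj (del_vertex H z)) u v by apply: cdH; rewrite ?inE.
  apply: connect_sub => s t /and3P[sz tz st]; apply/connect1/and3P.
  by split=> //; apply: HK.
case: (maxH K (induced_sub _ _) nonsepK) => [|_]; first by split; rewrite ?vK.
by apply; apply/and3P; split=> //; apply: adjG.
Qed.

Lemma claw_freeP G :
  claw_free G <->
  forall z x1 x2 x3, adj G z x1 -> adj G z x2 -> adj G z x3 ->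
    x1 != x2 -> x1 != x3 -> x2 != x3 ->
    [|| adj G x1 x2, adj G x1 x3 | adj G x2 x3].
Proof.
split=> [cfG z x1 x2 x3 z1 z2 z3 n12 n13 n23 | cfG [f [finj _ fadj]]].
  apply/negPn/negP => /norP[a12 /norP[a13 a23]]; apply: cfG.
  have neq x : adj G z x -> z != x.
    by move=> zx; apply: contraTneq zx => ->; rewrite adj_irr.
  exists (fun i : 'I_4 => nth z [:: z; x1; x2; x3] i); split.
  - have uniqs : uniq [:: z; x1; x2; x3].
      by rewrite /= !inE !negb_or !neq // n12 n13 n23.
    move=> i j _ _ eq_ij; apply/val_inj/eqP.
    by rewrite -(nth_uniq z _ _ uniqs) ?eq_ij ?ltn_ord.
  - move=> i _; have zG := adj_verts z1.
    case: i => [[|[|[|[|//]]]]] /= _ //.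
    + exact: adj_verts_r z1.
    + exact: adj_verts_r z2.
    + exact: adj_verts_r z3.
  - move=> [[|[|[|[|//]]]] /= ?] [[|[|[|[|//]]]] /= ?] _ _;
      rewrite ?adj_irr ?z1 ?z2 ?z3 ?(negPf a12) ?(negPf a13) ?(negPf a23) //;
      by rewrite adj_sym ?z1 ?z2 ?z3 ?(negPf a12) ?(negPf a13) ?(negPf a23).
pose o k (lk : k < 4) := Ordinal lk.
have E k l (lk : k < 4) (ll : l < 4) :
    adj G (f (o k lk)) (f (o l ll)) = adj claw (o k lk) (o l ll).
  by apply: fadj; rewrite inE.
have N k l (lk : k < 4) (ll : l < 4) : k != l -> f (o k lk) != f (o l ll).
  move=> nkl; apply/eqP => /finj; rewrite !inE => /(_ isT isT)[] /eqP.
  by rewrite (negPf nkl).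
have := cfG (f (o 0 isT)) (f (o 1 isT)) (f (o 2 isT)) (f (o 3 isT)).
by rewrite !E !N //= => /(_ isT isT isT isT isT isT).
Qed.

End BlockGraphs.

Local Open Scope group_scope.

(** * Involutions with products of small order *)

Section ThreeTranspositions.
Variable T : finType.
Implicit Types (s t g : {perm T}) (x y z : T) (xs ys : seq T).

(** A final transposition corrects the image of the new point and leaves the earlier images
    alone. *)
Lemma exists_perm_map xs ys : uniq xs -> uniq ys -> size xs = size ys ->
  exists g : {perm T}, map g xs = ys.
Proof.
elim: xs ys => [|x xs IHxs] [|y ys] //=; first by exists 1.
case/andP=> xxs uxs /andP[yys uys] [/(IHxs _ uxs uys)[g def_ys]].
exists (g * tperm (g x) y); rewrite permM tpermL; congr (_ :: _).
rewrite -[RHS]def_ys; apply/eq_in_map => z zxs; rewrite permM tpermD //.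
  by rewrite (inj_eq perm_inj); apply: contraNneq xxs => ->.
by apply: contraNneq yys => ->; rewrite -def_ys map_f.
Qed.

(** What an isomorphism from [Tv S] transports: conjugates of transvections by isometries are
    transvections, and [transv_mul_order] bounds the order of a product of two. *)
Definition short_products s t : Prop :=
  forall g, (s * t ^ g) ^+ 2 = 1 \/ (s * t ^ g) ^+ 3 = 1.

Lemma not_short_products s t g x :
  ((s * t ^ g) ((s * t ^ g) x) != x) ->
  ((s * t ^ g) ((s * t ^ g) ((s * t ^ g) x)) != x) -> ~ short_products s t.
Proof.
move=> n2 n3 /(_ g)[] /(congr1 (fun h : {perm T} => h x)).
  by rewrite expgS expg1 !(permM (s * _)) perm1 => /eqP; rewrite (negPf n2).
by rewrite !expgS expg0 mulg1 !(permM (s * _)) perm1 => /eqP; rewrite (negPf n3).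
Qed.

Section Involution.
Variable t : {perm T}.
Hypothesis tt : involutive t.

Lemma uniq_add_pair xs x : {in xs, forall y, t y \in xs} -> uniq xs ->
    x \notin xs -> t x != x ->
  {in [:: x, t x & xs], forall y, t y \in [:: x, t x & xs]} /\
  uniq [:: x, t x & xs].
Proof.
move=> txs uxs xxs tx; split.
  move=> y; rewrite !inE => /or3P[/eqP->|/eqP->|/txs->]; rewrite ?tt ?eqxx ?orbT //.
rewrite /= uxs inE negb_or xxs eq_sym tx !andbT /=.
by apply: contra xxs => /txs; rewrite tt.
Qed.

(** Conjugating by the cyclic shift of the five points makes [t * t ^ g] a 5-cycle on them. *)
Lemma short_products_fixed x1 x3 x5 :
  uniq [:: x1; t x1; x3; t x3; x5] -> t x5 = x5 -> ~ short_products t t.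
Proof.
move=> u5 tx5; set x2 := t x1 in u5; set x4 := t x3 in u5.
have u5r : uniq (seq.rot 1 [:: x1; x2; x3; x4; x5]) by rewrite rot_uniq.
have [g /= [g1 g2 g3 g4 g5]] := exists_perm_map u5 u5r erefl.
have u2 : (t ^ g) x2 = x3 by rewrite -g1 permJ.
have u4 : (t ^ g) x4 = x5 by rewrite -g3 permJ.
have u5' : (t ^ g) x5 = x4 by rewrite -g4 permJ -/x4 tt.
move: u5; rewrite /= !inE !negb_or !andbT.
move=> /and4P[/and4P[_ x13 x14 x15] _ _ _].
apply: (@not_short_products t t g x1); rewrite !(permM t) -/x2 u2 -/x4 u4.
  by rewrite eq_sym.
by rewrite tx5 u5' eq_sym.
Qed.

(** Conjugating by the cyclic shift of the eight points gives a product with the 4-cycle [x1], [x3],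
    [x5], [x7]. *)
Lemma short_products_four_pairs x1 x3 x5 x7 :
  uniq [:: x1; t x1; x3; t x3; x5; t x5; x7; t x7] -> ~ short_products t t.
Proof.
move=> u8; set x2 := t x1 in u8; set x4 := t x3 in u8.
set x6 := t x5 in u8; set x8 := t x7 in u8.
have u8r : uniq (seq.rot 1 [:: x1; x2; x3; x4; x5; x6; x7; x8]).
  by rewrite rot_uniq.
have [g /= [g1 g2 g3 g4 g5 g6 g7 g8]] := exists_perm_map u8 u8r erefl.
have u2 : (t ^ g) x2 = x3 by rewrite -g1 permJ.
have u4 : (t ^ g) x4 = x5 by rewrite -g3 permJ.
have u6 : (t ^ g) x6 = x7 by rewrite -g5 permJ.
move: u8; rewrite /= !inE !negb_or !andbT =>
  /andP[/and5P[_ _ _ x15 /and3P[_ x17 _]] _].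
apply: (@not_short_products t t g x1); rewrite !(permM t) -/x2 u2 -/x4 u4.
  by rewrite eq_sym.
by rewrite -/x6 u6 eq_sym.
Qed.

(** Multiplying by the conjugate transposition of [t x1] and [x3] joins two pairs of [t] into a
    4-cycle. *)
Lemma short_products_tperm x1 x3 y z :
  uniq [:: x1; t x1; x3; t x3] -> y != z -> ~ short_products t (tperm y z).
Proof.
move=> u4 yz; set x2 := t x1 in u4; set x4 := t x3 in u4.
move: u4; rewrite /= !inE !negb_or !andbT.
move=> /and3P[/and3P[x12 x13 x14] /andP[x23 x24] x34].
have [||g [gy gz]] := @exists_perm_map [:: y; z] [:: x2; x3] _ _ erefl.
- by rewrite /= inE yz.
- by rewrite /= inE x23.
have e1 : (t * tperm y z ^ g) x1 = x3 by rewrite permM tpermJ gy gz tpermL.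
have e2 : (t * tperm y z ^ g) x3 = x4.
  by rewrite permM tpermJ gy gz -/x4 tpermD // eq_sym.
have e3 : (t * tperm y z ^ g) x4 = x2.
  by rewrite permM tpermJ gy gz /x4 tt tpermR.
by apply: (@not_short_products t (tperm y z) g x1);
  rewrite e1 e2 ?e3 eq_sym.
Qed.

(** Once [t] moves two pairs, a fixed point is excluded by [short_products_fixed] and a fourth pair
    by [short_products_four_pairs], so two or three pairs exhaust [T]. *)
Lemma short_products_cases : t != 1 -> short_products t t ->
  (exists x y, x != y /\ t = tperm x y) \/
  (forall x, t x != x) /\ (#|T| = 4 \/ #|T| = 6).
Proof.
move=> t1 short_t.
have [x1 tx1] : exists x, t x != x.
  apply/existsP; apply: contraNT t1; rewrite negb_exists => /forallP tE.
  by apply/eqP/permP => x; rewrite perm1; apply/eqP; move: (tE x); rewrite negbK.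
have [clos2 uniq2] := @uniq_add_pair [::] x1 (fun _ => id) isT isT tx1.
have [/existsP[x3 /andP[n3 tx3]] | only_x1] :=
    boolP [exists x, (x \notin [:: x1; t x1]) && (t x != x)]; last first.
  left; exists x1, (t x1); split; first by rewrite eq_sym.
  apply/permP => x; have [x2 | nx] := boolP (x \in [:: x1; t x1]).
    by move: x2; rewrite !inE => /orP[]/eqP->; rewrite ?tpermL ?tpermR ?tt.
  have: t x == x.
    by apply: contraNT only_x1 => tx; apply/existsP; exists x; rewrite nx.
  move: nx; rewrite !inE negb_or => /andP[n1 n2] /eqP->.
  by rewrite tpermD // eq_sym.
have [clos4 uniq4] := uniq_add_pair clos2 uniq2 n3 tx3.
have fpf x : t x != x.
  apply/negP => /eqP tx.
  have nx : x \notin [:: x3; t x3; x1; t x1].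
    rewrite !inE !negb_or; apply/and4P; split.
    - by apply: contraNneq tx3 => <-; rewrite tx.
    - by apply: contraNneq tx3 => eq_x; rewrite -[in X in X == _]eq_x -{1}tx eq_x tt.
    - by apply: contraNneq tx1 => <-; rewrite tx.
    - by apply: contraNneq tx1 => eq_x; rewrite -[in X in X == _]eq_x -{1}tx eq_x tt.
  apply: (short_products_fixed _ tx short_t (x1 := x3) (x3 := x1)).
  by rewrite -[_ :: _]/(rcons [:: x3; t x3; x1; t x1] x) rcons_uniq nx.
right; split=> //.
have cardT xs : uniq xs -> (forall x, x \in xs) -> #|T| = size xs.
  move=> uxs Txs; rewrite -(card_uniqP uxs); apply: eq_card => x.
  by rewrite Txs.
have [/forallP T4 | ] := boolP [forall x, x \in [:: x3; t x3; x1; t x1]].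
  by left; apply: (cardT _ uniq4).
rewrite negb_forall => /existsP[x5 n5].
have [clos6 uniq6] := uniq_add_pair clos4 uniq4 n5 (fpf x5).
have [/forallP T6 | ] := boolP [forall x, x \in [:: x5; t x5; x3; t x3; x1; t x1]].
  by right; apply: (cardT _ uniq6).
rewrite negb_forall => /existsP[x7 n7].
have [_ /short_products_four_pairs] := uniq_add_pair clos6 uniq6 n7 (fpf x7).
by case.
Qed.

End Involution.
End ThreeTranspositions.

(** * Labellings of classes of involutions by pairs *)

Section Pairs.
Variable F : finType.
Implicit Types (A B : {set F}) (x y z : F).

Definition symdiff A B := (A :\: B) :|: (B :\: A).

Lemma in_symdiff A B x : (x \in symdiff A B) = (x \in A) (+) (x \in B).
Proof. by rewrite in_setU !in_setD; case: (x \in A); case: (x \in B). Qed.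

Lemma pair_set A x y : #|A| = 2 -> x \in A -> y \in A -> x != y -> A = [set x; y].
Proof.
move=> A2 xA yA xy; apply/esym/eqP.
by rewrite eqEcard subUset !sub1set xA yA A2 cards2 xy.
Qed.

Lemma pair_other A x : #|A| = 2 -> x \in A ->
  exists2 y, x != y & A = [set x; y].
Proof.
move=> /eqP/cards2P[y [z [yz ->]]]; rewrite !inE => /orP[]/eqP->; first by exists z.
by exists y; rewrite 1?eq_sym // setUC.
Qed.

Lemma cardsI1 A B x : #|A| = 2 -> #|B| = 2 -> A != B -> x \in A -> x \in B ->
  #|A :&: B| = 1%N.
Proof.
move=> A2 B2 AB xA xB; apply/eqP; rewrite eqn_leq; apply/andP; split; last first.
  by apply/card_gt0P; exists x; rewrite inE xA.
rewrite -ltnS -A2 proper_card // properE subsetIl /=; apply: contra AB.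
by rewrite subsetI subxx eqEcard A2 B2 andbT.
Qed.

End Pairs.

(* Models the transvections of [Tv S] as transpositions of the set [F].       *)
Record labelling (gT : finGroupType) (F : finType) (C : {set gT})
    (lab : gT -> {set F}) : Prop := Labelling {
  label_conj : {in C, forall s g, s ^ g \in C};
  label_card : {in C, forall s, #|lab s| = 2};
  label_inj : {in C &, injective lab};
  label_commute : {in C &, forall s t, (s ^ t == s) = (#|lab s :&: lab t| != 1%N)};
  label_symdiff : {in C &, forall s t, #|lab s :&: lab t| = 1%N ->
    lab (s ^ t) = symdiff (lab s) (lab t)};
  label_noncommuting : {in C &, forall s t, s != t -> exists g, t ^ (s ^ g) != t}
}.

(** * Transpositions labelled by their supports *)

Section Transpositions.
Variable T : finType.
Implicit Types (s t g : {perm T}) (x y z : T).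

Definition transpositions : {set {perm T}} :=
  [set t | [exists x, exists y, (x != y) && (t == tperm x y)]].

Definition perm_support t : {set T} := [set x | t x != x].

Lemma transpositionsP t :
  reflect (exists x y, x != y /\ t = tperm x y) (t \in transpositions).
Proof.
rewrite inE; apply: (iffP existsP).
  case=> x /existsP[y /andP[xy /eqP->]].
  by exists x, y.
case=> x [y [xy ->]].
by exists x; apply/existsP; exists y; rewrite xy eqxx.
Qed.

Lemma perm_support_tperm x y : x != y -> perm_support (tperm x y) = [set x; y].
Proof.
move=> xy; apply/setP => z; rewrite !inE; case: tpermP => [->|->|/eqP zx /eqP zy].
- by rewrite eqxx eq_sym xy.
- by rewrite eqxx orbT xy.
- by rewrite eqxx (negPf zx) (negPf zy).
Qed.

Lemma transposition_labelling : labelling transpositions perm_support.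
Proof.
have suppC t : t \in transpositions -> #|perm_support t| = 2.
  by case/transpositionsP=> x [y [xy ->]]; rewrite perm_support_tperm // cards2 xy.
have inj : {in transpositions &, injective perm_support}.
  move=> s t /transpositionsP[x [y [xy ->]]] /transpositionsP[z [w [zw ->]]].
  rewrite !perm_support_tperm // => eq_xyzw.
  have: x \in [set z; w] by rewrite -eq_xyzw !inE eqxx.
  have: y \in [set z; w] by rewrite -eq_xyzw !inE eqxx orbT.
  rewrite !inE => /orP[]/eqP y_eq /orP[]/eqP x_eq; move: xy;
    rewrite x_eq y_eq ?eqxx //.
  by rewrite tpermC.
have conj : {in transpositions, forall s g, s ^ g \in transpositions}.
  move=> _ /transpositionsP[x [y [xy ->]]] g; apply/transpositionsP.
  by exists (g x), (g y); rewrite (inj_eq perm_inj) tpermJ.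
have sym s t : s \in transpositions -> t \in transpositions ->
    #|perm_support s :&: perm_support t| = 1%N ->
    perm_support (s ^ t) = symdiff (perm_support s) (perm_support t).
  move=> sC tC /eqP/cards1P[x /setP supp_x].
  have /andP[xs xt] : (x \in perm_support s) && (x \in perm_support t).
    by have := supp_x x; rewrite !inE eqxx.
  have [y xy def_s] := pair_other (suppC s sC) xs.
  have [z xz def_t] := pair_other (suppC t tC) xt.
  have yz : y != z.
    apply: contraNneq xy => yz; have := supp_x y.
    by rewrite in_setI def_s def_t yz !inE !eqxx !orbT eq_sym => /esym.
  have -> : s = tperm x y.
    apply: inj; rewrite ?perm_support_tperm //.
    by apply/transpositionsP; exists x, y.
  have -> : t = tperm x z.
    apply: inj; rewrite ?perm_support_tperm //.
    by apply/transpositionsP; exists x, z.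
  rewrite tpermJ tpermL tpermD // 1?eq_sym // !perm_support_tperm //;
    last by rewrite eq_sym.
  apply/setP => u; rewrite in_symdiff !inE.
  have [-> | ux] := eqVneq u x; first by rewrite (negPf xy) (negPf xz).
  have [-> | uy] := eqVneq u y; first by rewrite (negPf yz).
  by rewrite orbF.
split=> //.
  move=> s t sC tC; have [st1 | nst1] /= := eqVneq #|_| 1%N.
    apply/negP => /eqP eq_s; have := sym s t sC tC st1; rewrite eq_s => def_s.
    have/set0Pn[x] : perm_support s :&: perm_support t != set0.
      by rewrite -card_gt0 st1.
    move=> /setIP[xs xt]; have := in_symdiff (perm_support s) (perm_support t) x.
    by rewrite -def_s xs xt.
  have [-> | st] := eqVneq s t; first by rewrite conjgE mulKg eqxx.
  have suppst : perm_support s != perm_support t.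
    by apply: contraNneq st => /inj->.
  have disj x : x \in perm_support s -> t x = x.
    move=> xs; have [//| xt] := eqVneq (t x) x; case/eqP: nst1.
    by apply: (cardsI1 (suppC s sC) (suppC t tC) suppst xs); rewrite inE.
  case/transpositionsP: sC disj => x [y [xy ->]] disj; rewrite tpermJ !disj ?eqxx //.
    by rewrite perm_support_tperm // !inE eqxx orbT.
  by rewrite perm_support_tperm // !inE eqxx.
move=> s t sC tC st.
have [z zs zt] : exists2 z, z \in perm_support s & z \notin perm_support t.
  apply/subsetPn; apply: contra st => sub; apply/eqP/inj => //; apply/eqP.
  by rewrite eqEcard sub !suppC.
case/transpositionsP: sC => x1 [x2 [x12 def_s]].
case/transpositionsP: tC zt => y1 [y2 [y12 ->]]; rewrite perm_support_tperm // !inE.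
rewrite negb_or => /andP[zy1 zy2].
(* This makes [s ^ g] the transposition of [y2] and [z], which shares exactly one point with [t]. *)
have [||g [gx1 gx2]] := @exists_perm_map _ [:: x1; x2] [:: y2; z] _ _ erefl.
- by rewrite /= inE x12.
- by rewrite /= inE eq_sym zy2.
exists g; rewrite def_s (tpermJ x1) gx1 gx2 tpermJ tpermL tpermD //;
  last by rewrite eq_sym.
apply: contraNneq zy2 => /(congr1 (fun h : {perm T} => h y1)).
by rewrite !tpermL => ->.
Qed.

End Transpositions.

(** * Fixed point free involutions of degrees 4 and 6 *)

Section Codes.
Variable n : nat.
Implicit Types (s t : 'S_n) (c d : seq nat).

Definition perm_code t : seq nat := [seq nat_of_ord (t i) | i <- enum 'I_n].

(** Product of permutations encoded as lists of numbers, a form on which [vm_compute] can run the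
    finite checks. *)
Definition code_mul c d : seq nat := [seq nth 0%N d i | i <- c].

Lemma nth_perm_code t (i : 'I_n) : nth 0%N (perm_code t) i = t i.
Proof. by rewrite (nth_map i) ?size_enum_ord // nth_ord_enum. Qed.

Lemma perm_code_inj : injective perm_code.
Proof.
move=> s t eq_st; apply/permP => i; apply/val_inj.
by rewrite /= -!nth_perm_code eq_st.
Qed.

Lemma perm_codeM s t : perm_code (s * t) = code_mul (perm_code s) (perm_code t).
Proof.
by rewrite /code_mul -map_comp; apply: eq_map => i; rewrite /= nth_perm_code permM.
Qed.

Lemma perm_code_iota t : perm_code t \in permutations (iota 0 n).
Proof.
rewrite mem_permutations uniq_perm ?iota_uniq //.
  by rewrite (map_inj_uniq (inj_comp val_inj perm_inj)) enum_uniq.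
move=> i; rewrite mem_iota add0n /=; apply/mapP/idP => [[j _ ->]|ltin].
  exact: ltn_ord.
exists (t^-1 (Ordinal ltin)); rewrite ?mem_enum //.
by rewrite permKV.
Qed.

Definition fpf_codes : seq (seq nat) :=
  [seq c <- permutations (iota 0 n) |
    all (fun i => (nth 0%N c i != i) && (nth 0%N c (nth 0%N c i) == i)) (iota 0 n)].

Definition fpf_involutions : {set 'S_n} :=
  [set t : 'S_n | [forall i, (t i != i) && (t (t i) == i)]].

Lemma fpf_involutionP t :
  reflect (involutive t /\ forall i, t i != i) (t \in fpf_involutions).
Proof.
rewrite inE; apply: (iffP forallP) => [tE | [tt fpf] i]; last by rewrite fpf tt eqxx.
by split=> i; have /andP[? /eqP] := tE i.
Qed.

Lemma fpf_involution_code t : t \in fpf_involutions -> perm_code t \in fpf_codes.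
Proof.
case/fpf_involutionP=> tt fpf; rewrite mem_filter perm_code_iota andbT.
apply/allP => i; rewrite mem_iota => /= ltin.
by rewrite (nth_perm_code t (Ordinal ltin)) nth_perm_code tt eqxx andbT fpf.
Qed.

Lemma fpf_involutionJ : {in fpf_involutions, forall s g, s ^ g \in fpf_involutions}.
Proof.
move=> s /fpf_involutionP[ss fpf] g; apply/fpf_involutionP; split=> i.
  by rewrite -[i](permKV g) !permJ ss.
by rewrite -[i](permKV g) permJ (inj_eq perm_inj).
Qed.

Lemma fpf_conjE s t : t \in fpf_involutions -> s ^ t = t * s * t.
Proof.
case/fpf_involutionP=> tt _; rewrite conjgE mulgA; congr (_ * _ * _).
by apply: (mulgI t); rewrite mulgV; apply/permP => i; rewrite permM tt perm1.
Qed.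

End Codes.

(** These are the three double transpositions of the Klein four-group. *)
Lemma fpf_involutions4_commute :
  {in fpf_involutions 4 &, forall s t : 'S_4, s ^ t = s}.
Proof.
move=> s t sC tC; apply: perm_code_inj; rewrite fpf_conjE // !perm_codeM.
have: all (fun c => all (fun d => code_mul (code_mul d c) d == c) (fpf_codes 4))
  (fpf_codes 4) by vm_compute.
move=> /allP/(_ _ (fpf_involution_code sC)).
by move=> /allP/(_ _ (fpf_involution_code tC))/eqP.
Qed.

Definition swap0 (k i : nat) : nat :=
  if i == 0%N then k else if i == k then 0%N else i.

(* The five fixed point free involutions [(0 i)(i+1 i-1)(i+2 i-2)] (modulo 5, *)
(* with values in 1..5) partition the pairs of points of [{0..5}].            *)
Definition total0 : seq (seq nat) :=
  [:: [:: 1; 0; 5; 4; 3; 2]; [:: 2; 3; 0; 1; 5; 4]; [:: 3; 5; 4; 0; 2; 1];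
      [:: 4; 2; 1; 5; 0; 3]; [:: 5; 4; 3; 2; 1; 0]]%N.

Definition code_label (c : seq nat) (k : nat) : bool :=
  [seq swap0 k (nth 0%N c (swap0 k i)) | i <- iota 0 6] \in total0.

(* The outer automorphism of ['S_6]: its images of [total0] under the         *)
(* transpositions [(0 k)] are the six partitions of the pairs of points into  *)
(* synthemes, and each syntheme lies in exactly two of them.                  *)
Definition syntheme_label (t : 'S_6) : {set 'I_6} :=
  [set k : 'I_6 | code_label (perm_code t) k].

Lemma card_ord_pred n (P : pred nat) :
  #|[set k : 'I_n | P k]| = count P (iota 0 n).
Proof.
by rewrite cardsE cardE size_filter -val_enum_ord count_map -enumT; apply: eq_count.
Qed.

(** Boolean versions on codes of [label_inj], [label_commute] and [label_symdiff], in this order. *)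
Definition check_pair c d : bool :=
  [&& all (fun k => code_label c k == code_label d k) (iota 0 6) ==> (c == d),
      (code_mul (code_mul d c) d == c) ==
        (count (fun k => code_label c k && code_label d k) (iota 0 6) != 1%N) &
      (count (fun k => code_label c k && code_label d k) (iota 0 6) == 1%N) ==>
      all (fun k => code_label (code_mul (code_mul d c) d) k ==
             code_label c k (+) code_label d k) (iota 0 6)].

Definition check_label c : bool :=
  (count (code_label c) (iota 0 6) == 2%N) && all (check_pair c) (fpf_codes 6).

Lemma check_labels : all check_label (fpf_codes 6).
Proof. by vm_compute. Qed.

Lemma syntheme_labelling : labelling (fpf_involutions 6) syntheme_label.
Proof.
have inter s t : #|syntheme_label s :&: syntheme_label t| =
    count (fun k => code_label (perm_code s) k && code_label (perm_code t) k)
      (iota 0 6).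
  rewrite -card_ord_pred; congr #|pred_of_set _|.
  by apply/setP => k; rewrite !inE.
have check s t : s \in fpf_involutions 6 -> t \in fpf_involutions 6 ->
    [/\ syntheme_label s = syntheme_label t -> s = t,
        (s ^ t == s) = (#|syntheme_label s :&: syntheme_label t| != 1%N) &
        #|syntheme_label s :&: syntheme_label t| = 1%N ->
        syntheme_label (s ^ t) = symdiff (syntheme_label s) (syntheme_label t)].
  move=> sC tC; have /allP/(_ _ (fpf_involution_code sC))/andP[_] := check_labels.
  move=> /allP/(_ _ (fpf_involution_code tC))/and3P[inj_lab /eqP comm_lab sym_lab].
  rewrite inter -comm_lab -(inj_eq (@perm_code_inj 6)) fpf_conjE // !perm_codeM.
  split=> // [eq_lab | m1].
    apply/perm_code_inj/eqP/(implyP inj_lab)/allP => k; rewrite mem_iota => ltk6.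
    by have /setP/(_ (Ordinal ltk6)) := eq_lab; rewrite !inE => ->.
  apply/setP => k; rewrite in_symdiff !inE !perm_codeM.
  move: sym_lab; rewrite m1 => /allP/(_ k).
  by rewrite mem_iota ltn_ord => /(_ isT)/eqP.
split.
- exact: fpf_involutionJ.
- move=> s /fpf_involution_code; rewrite card_ord_pred => sC.
  by have /allP/(_ _ sC)/andP[/eqP] := check_labels.
- by move=> s t sC tC; have [] := check s t sC tC.
- by move=> s t sC tC; have [] := check s t sC tC.
- by move=> s t sC tC; have [] := check s t sC tC.
move=> s t /fpf_involutionP[ss fpfs] /fpf_involutionP[tt fpft] _.
have six (r : 'S_6) : involutive r -> (forall i, r i != i) ->
    exists x1 x3 x5, uniq [:: x1; r x1; x3; r x3; x5; r x5].
  move=> rr fpf; pose x1 : 'I_6 := ord0.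
  have [clos2 uniq2] := @uniq_add_pair _ r rr [::] x1 (fun _ => id) isT isT (fpf x1).
  have extend (xs : seq 'I_6) : (size xs < 6)%N -> exists x : 'I_6, x \notin xs.
    move=> lt6; apply/existsP; apply: contraTT lt6.
    rewrite negb_exists -leqNgt => /forallP xs6.
    have := subset_leq_card (_ : [set: 'I_6] \subset xs).
    rewrite cardsT card_ord => le6; apply: leq_trans (le6 _) (card_size xs).
    by apply/subsetP => x _; move: (xs6 x); rewrite negbK.
  have [x3 n3] := extend [:: x1; r x1] isT.
  have [clos4 uniq4] := uniq_add_pair rr clos2 uniq2 n3 (fpf x3).
  have [x5 n5] := extend [:: x3; r x3; x1; r x1] isT.
  have [_ uniq6] := uniq_add_pair rr clos4 uniq4 n5 (fpf x5).
  by exists x5, x3, x1.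
have [x1 [x3 [x5 ux]]] := six s ss fpfs; have [y1 [y3 [y5 uy]]] := six t tt fpft.
(* The rotation makes the pairs of [s ^ g] alternate with those of [t] around a hexagon, so the two
   involutions do not commute. *)
have uyr : uniq (seq.rot 1 [:: y1; t y1; y3; t y3; y5; t y5]) by rewrite rot_uniq.
have [g /= [g1 g2 g3 g4 g5 g6]] := exists_perm_map ux uyr erefl.
exists g; apply/eqP => t_fix.
have u2 : (s ^ g) (t y1) = y3 by rewrite -g1 permJ.
have u1 : (s ^ g) y1 = t y5 by rewrite -g6 permJ ss g5.
have: (t ^ (s ^ g)) ((s ^ g) y1) = y3 by rewrite permJ u2.
rewrite t_fix u1 tt => y53; move: uy.
by rewrite y53 /= !inE eqxx !orbT /= !andbF.
Qed.

Import GRing.Theory.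
Local Open Scope ring_scope.

(** * Claw-free block graphs as line graphs of trees *)

Section FreeSets.
Variables (V : vectType 'F_2).
Local Notation fV := (finvect_type V).
Implicit Types (a b c : fV) (S X : {set fV}).

Lemma addvv a : a + a = 0.
Proof.
have: (1 + 1 : 'F_2) *: a = 0 by rewrite (_ : 1 + 1 = 0) ?scale0r //; apply/val_inj.
by rewrite scalerDl scale1r.
Qed.

Lemma addvK a b : a + b + b = a.
Proof. by rewrite -addrA addvv addr0. Qed.

Lemma addKv a b : a + (a + b) = b.
Proof. by rewrite addrA addvv add0r. Qed.

Lemma addv_eq0 a b : (a + b == 0) = (a == b).
Proof.
apply/eqP/eqP => [ab0 | ->]; last exact: addvv.
by rewrite -[a](addvK _ b) ab0 add0r.
Qed.

Lemma span_setU1 a S : <<enum (a |: S)>>%VS = (<[a]> + <<enum S>>)%VS.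
Proof.
by rewrite -span_cons; apply: eq_span => x; rewrite mem_enum !inE mem_enum.
Qed.

Lemma free_setU1 a S : a \notin S ->
  free (enum (a |: S)) = (a \notin <<enum S>>%VS) && free (enum S).
Proof.
move=> aS; rewrite -free_cons; apply/perm_free/uniq_perm.
- exact: enum_uniq.
- by rewrite /= mem_enum aS enum_uniq.
- by move=> x; rewrite mem_enum !inE mem_enum.
Qed.

Lemma free_subset S S' : S' \subset S -> free (enum S) -> free (enum S').
Proof.
move=> sS /(filter_free (mem S')); rewrite (perm_free (Y := enum S')) //.
apply: uniq_perm => [||x]; [exact/filter_uniq/enum_uniq | exact: enum_uniq |].
by rewrite mem_filter !mem_enum; apply: andb_idr; apply: (subsetP sS).
Qed.

Lemma free_notin_span a S :
  free (enum S) -> a \in S -> a \notin <<enum (S :\ a)>>%VS.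
Proof.
move=> frS aS; move: frS; rewrite -(setD1K aS) free_setU1 ?setD11 //.
by case/andP; rewrite setU1K ?setD11.
Qed.

Lemma free_neq0 a S : free (enum S) -> a \in S -> a != 0.
Proof.
by move=> frS /(free_notin_span frS); apply: contraNneq => ->; apply: mem0v.
Qed.

Lemma free_add_notin a b c S : free (enum S) -> a \in S -> b \in S -> c \in S ->
  a != c -> b != c -> a + b != c.
Proof.
move=> frS aS bS cS ac bc; apply: contraTneq (free_notin_span frS cS) => def_c.
by rewrite negbK -{1}def_c rpredD // memv_span // mem_enum in_setD1 ?ac ?bc.
Qed.

End FreeSets.

(** * The form as a boolean relation, and trees of vectors *)

Section Form.
Variables (V : vectType 'F_2) (B : symplectic_form V).
Local Notation fV := (finvect_type V).
Implicit Types (a b c p q r s v x y : fV) (S X P : {set fV}).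

(** With boolean values, addition in ['F_2] becomes exclusive or and identities reduce to case
    analysis. *)
Definition linked (a b : fV) : bool := B a b == 1.

Lemma linkedDl a b c : linked (a + b) c = linked a c (+) linked b c.
Proof.
rewrite /linked (linearDl B c a b).
by case: (B a c) (B b c) => [[|[|//]] ?] [[|[|//]] ?].
Qed.

Lemma linkedC a b : linked a b = linked b a.
Proof. by rewrite /linked form_sym. Qed.

Lemma linkedDr a b c : linked c (a + b) = linked c a (+) linked c b.
Proof. by rewrite !(linkedC c) linkedDl. Qed.

Lemma linkedxx a : linked a a = false.
Proof. by rewrite /linked form_alt. Qed.

Lemma linked0v a : linked 0 a = false.
Proof. by rewrite -(addvv 0) linkedDl addbb. Qed.

Lemma linkedv0 a : linked a 0 = false.
Proof. by rewrite linkedC linked0v. Qed.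

Lemma linked_neq a b : linked a b -> a != b.
Proof. by apply: contraTneq => ->; rewrite linkedxx. Qed.

Lemma transvE a b : transv B a b = b + a *+ linked b a.
Proof.
rewrite permE /transv_fun /linked; congr (_ + _).
case: (B b a) => [[|[|//]] ?] //=.
  by apply: etrans (scale0r _); congr (_ *: _); apply/val_inj.
by apply: etrans (scale1r _); congr (_ *: _); apply/val_inj.
Qed.

Lemma form_graphE S a b :
  adj (form_graph B S) a b = [&& a \in S, b \in S & linked a b].
Proof. by []. Qed.

Lemma radicalPn a : a \notin radical B -> exists b, linked a b.
Proof.
rewrite inE negb_forall => /existsP[b]; rewrite /linked => ab; exists b.
by move: ab; case: (B a b) => [[|[|//]] ?].
Qed.

(* A graph [G(S)] that is the line graph of a tree comes with a spanning set  *)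
(* [P] of points (the vertices of the tree, one of which is [0]) such that    *)
(* the edge of [S] with end points [p] and [q] is the vector [p + q].         *)
Record tree_points (S P : {set fV}) : Prop := TreePoints {
  tree_point0 : 0 \in P;
  tree_card : #|P| = #|S|.+1;
  tree_span : <<enum P>>%VS = <<enum S>>%VS;
  tree_form : {in P &, forall p q,
    linked p q = true (+) (p == 0) (+) (q == 0) (+) (p == q)};
  tree_edge : {in S, forall a, exists p q, [/\ p \in P, q \in P & a = p + q]};
  tree_connected : forall X, 0 \in X ->
    {in P &, forall p q, p + q \in S -> p \in X -> q \in X} -> P \subset X
}.

Section TreePoints.
Variables (S P : {set fV}).
Hypotheses (freeS : free (enum S)) (treeP : tree_points S P).

Let P0 : 0 \in P := tree_point0 treeP.

(** In the expansion by [tree_form] the constants and the comparisons with [0] cancel. *)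
Lemma tree_dot : {in P & &, forall p q r, {in P, forall s,
  linked (p + q) (r + s) = (p == r) (+) (p == s) (+) (q == r) (+) (q == s)}}.
Proof.
move=> p q r pP qP rP s sP; rewrite linkedDl !linkedDr !(tree_form treeP) //.
by case: (p == 0); case: (q == 0); case: (r == 0); case: (s == 0);
  case: (p == r); case: (p == s); case: (q == r); case: (q == s).
Qed.

(** [P :\ 0] spans the same space as [S] and has as many elements. *)
Lemma tree_free : free (enum (P :\ 0)).
Proof.
rewrite /free -cardE.
have ->: <<enum (P :\ 0%R)>>%VS = <<enum S>>%VS.
  rewrite -(tree_span treeP) -[P in RHS](setD1K P0) span_setU1.
  by apply/esym/addv_idPr; rewrite -memvE mem0v.
have := freeS; rewrite /free -cardE => /eqP->.
by have := cardsD1 (0 : fV) P; rewrite P0 (tree_card treeP) => -[->].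
Qed.

(** Otherwise a nonzero one among [p] and [q] would be the sum of three points different from it,
    against [tree_free]. *)
Lemma tree_uniq_ends : {in P & &, forall p q r, {in P, forall s,
  p + q = r + s -> p != q -> (p == r) || (p == s)}}.
Proof.
have indep x y z t : x \in P -> y \in P -> z \in P -> t \in P -> x != 0 ->
    x != y -> x != z -> x != t -> x != y + z + t.
  move=> xP yP zP tP x0 xy xz xt.
  have x1 : x \in P :\ 0 by rewrite in_setD1 x0.
  apply: contraTneq (free_notin_span tree_free x1) => def_x.
  rewrite negbK [X in X \in _]def_x.
  have sp u : u \in P -> x != u -> u \in <<enum ((P :\ 0%R) :\ x)>>%VS.
    move=> uP xu; have [-> | u0] := eqVneq u 0; first exact: mem0v.
    by apply: memv_span; rewrite mem_enum !in_setD1 eq_sym xu u0.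
  by rewrite !rpredD ?sp.
move=> p q r pP qP rP s sP eq_pqrs pq; apply/norP => -[pr ps].
have def_p : p = q + r + s by rewrite -addrA -eq_pqrs addrC addvK.
have [p0 | p0] := eqVneq p 0; last first.
  by have := indep p q r s pP qP rP sP p0 pq pr ps; rewrite -def_p eqxx.
have def_q' : q = r + s by rewrite -eq_pqrs p0 add0r.
have def_q : q = 0 + r + s by rewrite add0r.
have q0 : q != 0 by rewrite eq_sym -p0.
have qr : q != r.
  by apply: contraNneq ps => qr; rewrite p0 -(addKv r s) -def_q' -qr addvv.
have qs : q != s.
  by apply: contraNneq pr => qs; rewrite p0 -(addvK r s) -def_q' -qs addvv.
by have := indep q 0 r s qP P0 rP sP q0 q0 qr qs; rewrite -def_q eqxx.
Qed.

End TreePoints.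

(** * Attaching a new edge to the tree *)

Section Extend.
Variables (T S P : {set fV}) (a : fV).
Hypotheses (freeT : free (enum T)) (clawT : claw_free (form_graph B T)).
Hypotheses (cycleT : cycle_closed (form_graph B T)).
Hypotheses (sST : S \subset T) (aT : a \in T) (aS : a \notin S).
Hypotheses (connS : connected (form_graph B S)) (treeP : tree_points S P).

Let freeS : free (enum S) := free_subset sST freeT.
Let inT x : x \in S -> x \in T := subsetP sST x.
Let neq_a x : x \in S -> x != a.
Proof. by move=> xS; apply: contraNneq aS => <-. Qed.

Let cycle x y z : x \in T -> y \in T -> z \in T -> y != z ->
    linked x y -> linked x z -> connect (del_adj (form_graph B T) x) y z ->
  linked y z.
Proof.
move=> xT yT zT yz xy xz con.
by have := cycleT _ _ yz con; rewrite !form_graphE xT yT zT => /(_ xy xz).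
Qed.

(** [S] is connected and does not contain [a], so [b] and [c] are joined by a path avoiding [a] and
    the cycle condition applies. *)
Let clique b c : b \in S -> c \in S -> b != c -> linked a b -> linked a c ->
  linked b c.
Proof.
move=> bS cS bc ab ac; apply: (cycle aT _ _ bc ab ac); [exact: inT..|].
have: connect (adj (form_graph B S)) b c := connS bS cS.
apply: connect_sub => u v /and3P[uS vS uv]; apply/connect1/and3P.
by split; rewrite ?neq_a // form_graphE !inT.
Qed.

Let edge_neq0 p q : p + q \in S -> p != q.
Proof. by move/(free_neq0 freeS); rewrite addv_eq0. Qed.

Let star p q s : p \in P -> q \in P -> s \in P -> p + q \in S -> p + s \in S ->
  q != s -> linked (p + q) (p + s).
Proof.
move=> pP qP sP /edge_neq0 pq /edge_neq0 ps qs.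
by rewrite (tree_dot treeP) // eqxx (negPf ps) (eq_sym q) (negPf pq) (negPf qs).
Qed.

Let ends_neq p q x y : p \in P -> q \in P -> x \in P -> y \in P ->
  p + q \in S -> p != x -> p != y -> p + q != x + y.
Proof.
move=> pP qP xP yP bS px py; apply: contraNneq px => eq_b.
have := tree_uniq_ends freeS treeP pP qP xP yP eq_b (edge_neq0 bS).
by rewrite (negPf py) orbF.
Qed.

(** Any further edge at [p] is joined to [a] through [p + r], outside [p + q], hence is adjacent to
    [a]. An edge off [p] adjacent to [a] would meet both [p + q] and [p + r], hence be their sum
    [q + r], against independence. *)
Let step_two p q r : p \in P -> q \in P -> r \in P ->
    p + q \in S -> p + r \in S -> q != r -> linked a (p + q) ->
    linked a (p + r) ->
  {in P &, forall x y, x + y \in S -> linked a (x + y) = (x == p) (+) (y == p)}.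
Proof.
move=> pP qP rP bS cS qr ab ac x y xP yP.
have pq := edge_neq0 bS; have pr := edge_neq0 cS.
have bc : p + q != p + r by apply: contraNneq qr => /addrI->.
have cross s : s \in P -> p + s \in S -> linked a (p + s).
  move=> sP dS; have [<- // | qs] := eqVneq q s; have [<- // | rs] := eqVneq r s.
  apply: (cycle (inT bS) aT (inT dS)).
  - by rewrite eq_sym neq_a.
  - by rewrite linkedC.
  - exact: star.
  apply: (@connect_trans _ _ (p + r)); apply/connect1/and3P; split=> //.
  - by rewrite eq_sym neq_a.
  - by rewrite eq_sym.
  - by rewrite form_graphE aT inT.
  - by rewrite eq_sym.
  - by apply: contraNneq qs => /addrI->.
  - by rewrite form_graphE !inT ?star.
have [-> | xp] := eqVneq x p.
  move=> dS; rewrite cross // (eq_sym y).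
  by rewrite (negPf (edge_neq0 dS)).
have [-> | yp] := eqVneq y p; first by rewrite addrC => dS; rewrite cross.
move=> dS; apply: contraNF (edge_neq0 dS) => ad.
have end_d s : s \in P -> p + s \in S -> linked a (p + s) -> (s == x) || (s == y).
  move=> sP sS as_; have sd : p + s != x + y by rewrite ends_neq // eq_sym.
  have := clique sS dS sd as_ ad; rewrite (tree_dot treeP) //.
  by rewrite !(eq_sym p) (negPf xp) (negPf yp); case: (s == x).
have def_d : p + q + (p + r) = x + y.
  rewrite addrACA addvv add0r.
  case/orP: (end_d q qP bS ab) (end_d r rP cS ac) => /eqP def_q.
    case/orP=> /eqP def_r; first by rewrite def_q def_r eqxx in qr.
    by rewrite def_q def_r.
  case/orP=> /eqP def_r; first by rewrite def_q def_r addrC.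
  by rewrite def_q def_r eqxx in qr.
have := free_add_notin freeS bS cS dS; rewrite def_d eqxx.
by rewrite !ends_neq ?(eq_sym p) // => /(_ isT isT).
Qed.

(** Here [p] is a leaf, and the only edge at it is the only neighbour of [a]. *)
Let step_one p q : p \in P -> q \in P -> p + q \in S -> linked a (p + q) ->
    {in S, forall c, linked a c -> c = p + q} ->
    {in P, forall s, p + s \in S -> s = q} ->
  {in P &, forall x y, x + y \in S -> linked a (x + y) = (x == p) (+) (y == p)}.
Proof.
move=> pP qP bS ab only_b only_q x y xP yP.
have [-> | xp] := eqVneq x p.
  move=> dS; rewrite (eq_sym y) (negPf (edge_neq0 dS)).
  by rewrite (only_q y).
have [-> | yp] := eqVneq y p.
  by rewrite addrC => dS; rewrite (only_q x).
move=> dS; apply/negP => /(only_b _ dS)/eqP.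
by rewrite eq_sym (negPf (ends_neq _ _ _ _ bS _ _)) // eq_sym.
Qed.

(** The neighbours of [a] are the edges at one vertex [i]. Two neighbours are adjacent by [clique],
    hence share this vertex; a single neighbour has a leaf among its ends, since the graph has no
    claw. *)
Lemma exists_attaching_point :
    S = set0 \/ (exists2 b, b \in S & linked a b) ->
  exists2 i, i \in P &
  {in P &, forall p q, p + q \in S -> linked a (p + q) = (p == i) (+) (q == i)}.
Proof.
case=> [S0 | [b bS ab]].
  by exists 0 => [|p q]; rewrite ?(tree_point0 treeP) ?S0 ?inE.
have [p [q [pP qP def_b]]] := tree_edge treeP bS.
have [/exists_inP[c cS /andP[cb ac]] | only_b] :=
    boolP [exists c in S, (c != b) && linked a c].
  have [r [s [rP sP def_c]]] := tree_edge treeP cS.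
  have bc := clique bS cS; rewrite eq_sym in bc; move: (bc cb ab ac).
  have key x y z : x \in P -> y \in P -> z \in P -> b = x + y -> c = x + z ->
      exists2 i, i \in P &
      {in P &, forall p q, p + q \in S -> linked a (p + q) = (p == i) (+) (q == i)}.
    move=> xP yP zP b_xy c_xz; exists x => //.
    apply: (step_two xP yP zP); rewrite -?b_xy -?c_xz //.
    by apply: contraNneq cb => yz; rewrite b_xy c_xz yz.
  rewrite {1}def_b {1}def_c (tree_dot treeP) //.
  have [pr _ | _] := eqVneq p r; first by apply: (key p q s); rewrite // pr.
  have [ps _ | _] := eqVneq p s.
    by apply: (key p q r); rewrite // ps addrC.
  have [qr _ | _] := eqVneq q r.
    by apply: (key q p s); rewrite // addrC // qr addrC.
  have [qs _ | //] := eqVneq q s.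
  by apply: (key q p r); rewrite // addrC // qs.
have {}only_b : {in S, forall c, linked a c -> c = b}.
  move=> c cS ac; apply/eqP; apply: contraNT only_b => cb.
  by apply/exists_inP; exists c; rewrite // cb.
rewrite {}def_b in bS ab only_b.
have [/forall_inP only_q | ] :=
    boolP [forall s in P, (p + s \in S) ==> (s == q)].
  exists p => //; apply: (step_one pP qP) => // s sP sS.
  by apply/eqP; move: (only_q s sP); rewrite sS.
have [/forall_inP only_p _ | ] :=
    boolP [forall s in P, (q + s \in S) ==> (s == p)].
  exists q => //; apply: (@step_one q p); rewrite 1?addrC //.
  move=> s sP sS; by apply/eqP; move: (only_p s sP); rewrite sS.
(* Both ends carry another edge, so [p + q] has the neighbours [a], [p + s] and [q + u]. Only the
   last two can be adjacent; then [s = u], and the triangle contradicts independence. *)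
move=> /forall_inPn[u uP]; rewrite negb_imply => /andP[eS up].
move=> /forall_inPn[s sP]; rewrite negb_imply => /andP[dS sq].
have db : p + s != p + q by apply: contraNneq sq => /addrI->.
have eb : q + u != p + q by rewrite addrC (inj_eq (addIr q)).
have nad x : x \in S -> x != p + q -> linked a x = false.
  by move=> xS; apply: contraNF => /(only_b _ xS)->.
have b_d : linked (p + q) (p + s) by rewrite star // eq_sym.
have b_e : linked (p + q) (q + u).
  by rewrite addrC in bS *; rewrite star // eq_sym.
have := (claw_freeP _).1 clawT (p + q) a (p + s) (q + u).
rewrite !form_graphE aT !inT //= linkedC ab b_d b_e !nad //=.
rewrite !(eq_sym a) !neq_a // => /(_ isT isT isT isT isT).
have su_eq : p + s != q + u by rewrite ends_neq ?(edge_neq0 bS) // eq_sym.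
move=> /(_ su_eq); rewrite (tree_dot treeP) //.
rewrite (negPf (edge_neq0 bS)) (eq_sym p) (negPf up) (negPf sq) /= => /eqP su.
have := free_add_notin freeS dS eS bS db eb.
by rewrite su addrACA [u + u]addvv addr0 eqxx.
Qed.

(** The new edge [a] joins the attaching point [i] to a new leaf, the vector [a + i]. *)
Lemma tree_points_setU1 :
    S = set0 \/ (exists2 b, b \in S & linked a b) ->
  exists P', tree_points (a |: S) P'.
Proof.
move=> adj_a; have [i iP cross] := exists_attaching_point adj_a.
have P0 := tree_point0 treeP.
have linked_a : {in P, forall p, linked a p = (p == i) (+) (0 == i)}.
  (* The values on the edges determine those on the points, starting at [0] and moving along the
     tree. *)
  pose X := [set p in P | linked a p == (p == i) (+) (0 == i)].
  suff sPX : P \subset X by move=> p /(subsetP sPX); rewrite inE => /andP[_ /eqP].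
  apply: (tree_connected treeP); first by rewrite inE P0 linkedv0 addbb.
  move=> p q pP qP pqS; rewrite !inE pP qP /= => /eqP ap.
  have := cross p q pP qP pqS; rewrite linkedDr ap.
  by case: (linked a q); case: (p == i); case: (q == i); case: (0 == i).
have aspan : a \notin <<enum S>>%VS.
  apply: contra (free_notin_span freeT aT); apply/subvP.
  apply: sub_span => x; rewrite !mem_enum !inE => xS.
  by rewrite neq_a // inT.
have memP p : p \in P -> p \in <<enum S>>%VS.
  by move=> pP; rewrite -(tree_span treeP) memv_span ?mem_enum.
have nP : a + i \notin P.
  apply: contra aspan => /memP nS.
  by rewrite -(addvK a i) rpredD // memP.
have nneq p : p \in P -> (a + i == p) = false.
  by move=> pP; apply: contraNF nP => /eqP->.
have n0 := nneq _ P0.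
have linked_n : {in P, forall p, linked (a + i) p = true (+) (p == 0)}.
  move=> p pP; rewrite linkedDl linked_a // (tree_form treeP) //.
  rewrite !(eq_sym i) (eq_sym p i).
  by case: (0 == i); case: (p == 0); case: (i == p).
exists ((a + i) |: P); split.
- by rewrite inE P0 orbT.
- by rewrite !cardsU1 nP aS (tree_card treeP).
- rewrite !span_setU1 (tree_span treeP); apply/eqP; rewrite eqEsubv !subv_add.
  rewrite !addvSr !andbT -!memvE; apply/andP; split.
    by rewrite memv_add ?memv_line ?memP.
  by rewrite -[a in a \in _](addvK a i) memv_add ?memv_line ?memP.
- move=> p q; rewrite !in_setU1.
  case/predU1P=> [-> | pP]; case/predU1P=> [-> | qP].
  + by rewrite linkedxx eqxx n0.
  + by rewrite linked_n // n0 nneq // addbF.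
  + by rewrite linkedC linked_n // n0 (eq_sym p (a + i)) nneq // !addbF.
  + exact: (tree_form treeP).
- move=> b; rewrite in_setU1 => /predU1P[-> | bS].
    by exists (a + i), i; rewrite !in_setU1 eqxx iP orbT addvK.
  have [p [q [pP qP def_b]]] := tree_edge treeP bS.
  by exists p, q; rewrite !in_setU1 pP qP !orbT.
move=> X X0 closedX.
have sPX : P \subset X.
  apply: (tree_connected treeP) => // p q pP qP pqS.
  by apply: closedX; rewrite !in_setU1 ?pP ?qP ?pqS orbT.
rewrite subUset sub1set sPX andbT; apply: (closedX i).
- by rewrite in_setU1 iP orbT.
- by rewrite in_setU1 eqxx.
- by rewrite addrCA addvv addr0 in_setU1 eqxx.
- exact: (subsetP sPX).
Qed.

Lemma connected_setU1 :
    S = set0 \/ (exists2 b, b \in S & linked a b) ->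
  connected (form_graph B (a |: S)).
Proof.
case=> [-> | [b bS ab]] x y /=.
  by rewrite setU0 !inE => /eqP-> /eqP->.
have con_b z : z \in a |: S -> connect (form_adj B (a |: S)) z b.
  rewrite in_setU1 => /predU1P[-> | zS].
    by apply/connect1/and3P; split; rewrite // in_setU1 ?eqxx ?bS ?orbT.
  have: connect (adj (form_graph B S)) z b := connS zS bS.
  apply: connect_sub => u v /and3P[uS vS uv].
  by apply/connect1/and3P; rewrite !in_setU1 uS vS !orbT.
move=> /con_b xb /con_b; rewrite (connect_adj_sym (form_graph B (a |: S))).
exact: connect_trans.
Qed.

End Extend.

Lemma exists_tree_points S :
    free (enum S) -> connected (form_graph B S) ->
    claw_free (form_graph B S) -> cycle_closed (form_graph B S) ->
  exists P, tree_points S P.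
Proof.
move=> freeS conS clawS cycS.
suff [S' [sS'S card_S' _ treeS']] : exists S' : {set fV},
    [/\ S' \subset S, #|S'| = #|S|, connected (form_graph B S') &
        exists P, tree_points S' P].
  suff <- : S' = S by [].
  by apply/eqP; rewrite eqEcard sS'S card_S' leqnn.
(* Separating the size from [#|S|] allows an induction through connected subsets of every smaller
   size. *)
have [k le_k] : exists k, k = #|S| /\ (k <= #|S|)%N by exists #|S|.
rewrite -{}le_k.1; case: le_k => _; elim: k => [_ | k IHk ltkS].
  exists set0; split; rewrite ?sub0set ?cards0 //; first by move=> x; rewrite inE.
  exists [set 0]; split; rewrite ?cards1 ?cards0 ?inE //.
  - rewrite -[[set 0] in LHS]setU0 span_setU1.
    by apply/addv_idPr; rewrite -memvE mem0v.
  - by move=> p q; rewrite !inE => /eqP-> /eqP->; rewrite linkedxx eqxx.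
  - by move=> a; rewrite inE.
  - by move=> X X0 _; rewrite sub1set.
have [S' [sS'S card_S' conS' [P treeS']]] := IHk (ltnW ltkS).
have ltS' : S' \proper S by rewrite properEcard sS'S card_S'.
have [a aS [aS' adj_a]] : exists2 a, a \in S & a \notin S' /\
    (S' = set0 \/ exists2 b, b \in S' & linked a b).
  have /properP[_ [y yS yS']] := ltS'.
  have [-> | [x xS']] := set_0Vmem S'.
    by exists y; rewrite ?inE //; split=> //; left.
  have [/exists_inP[a aSS' /exists_inP[b bS' ab]] | no_adj] :=
      boolP [exists a in S :\: S', exists b in S', linked a b].
    move: aSS'; rewrite inE => /andP[aS' aS]; exists a => //; split=> //.
    by right; exists b.
  have := conS x y (subsetP sS'S x xS') yS.
  (* With no edge leaving it, [S'] would be closed under adjacency, against the connectedness of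
     [S]. *)
  have closedS' : closed (form_adj B S) (mem S').
    apply: (intro_closed (connect_adj_sym (form_graph B S))).
    move=> u v /and3P[uS vS uv] uS'; apply: contraNT no_adj => vS'.
    apply/exists_inP; exists v; first by rewrite inE vS' vS.
    by apply/exists_inP; exists u; rewrite // linkedC.
  by move/(closed_connect closedS'); rewrite xS' (negPf yS').
exists (a |: S'); split.
- by rewrite subUset sub1set aS.
- by rewrite cardsU1 aS' card_S'.
- by apply: connected_setU1 (adj_a).
- exact: (tree_points_setU1 freeS clawS cycS sS'S aS aS' conS' treeS' adj_a).
Qed.

(** * Action of the permutations of the points on [V] *)

Section PointAction.
Variables (n : nat) (w : 'I_n -> fV) (k0 : 'I_n).
Hypothesis dotw : forall i j k l, linked (w i + w j) (w k + w l) =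
  (i == k) (+) (i == l) (+) (j == k) (+) (j == l).
Implicit Types (g h : 'S_n) (i j k l : 'I_n).

(** It sends [w i + w j] to [w (g i) + w (g j)] and fixes the vectors orthogonal to all points,
    without choosing a complement. *)
Definition point_fun g v : fV := v + \sum_i (w (g i) + w i) *+ linked v (w i).

Lemma mulrb_addb a (b c : bool) : a *+ (b (+) c) = a *+ b + a *+ c.
Proof. by case: b c => [] [] /=; rewrite ?addvv ?addr0 ?add0r. Qed.

Lemma linked_sum (I : finType) (F : I -> fV) x :
  linked (\sum_i F i) x = \big[addb/false]_i linked (F i) x.
Proof.
apply: (big_morph (fun y => linked y x)) => [a b|]; first exact: linkedDl.
exact: linked0v.
Qed.

Lemma linked_mulrb a (b : bool) x : linked (a *+ b) x = b && linked a x.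
Proof. by case: b; rewrite //= linked0v. Qed.

Lemma big_addb_pred1 (F : 'I_n -> bool) k :
  \big[addb/false]_i (F i && (i == k)) = F k.
Proof.
rewrite (bigD1 k) //= eqxx andbT big1 ?addbF // => i /negPf->.
by rewrite andbF.
Qed.

Lemma big_addb_perm1 (F : 'I_n -> bool) g k :
  \big[addb/false]_i (F i && (g i == g k)) = F k.
Proof.
rewrite -[RHS]big_addb_pred1; apply: eq_bigr => i _.
by rewrite (inj_eq perm_inj).
Qed.

Lemma linked_point_fun g v k l :
  linked (point_fun g v) (w (g k) + w (g l)) = linked v (w k + w l).
Proof.
rewrite linkedDl linked_sum.
under eq_bigr => i _ do rewrite linked_mulrb dotw !andb_addr.
rewrite !big_split /= !big_addb_perm1 !big_addb_pred1 !linkedDr.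
by case: (linked v (w k)); case: (linked v (w l)); case: (linked v (w (g k)));
  case: (linked v (w (g l))).
Qed.

Lemma sum_perm_add g : \sum_i (w (g i) + w i) = 0.
Proof.
rewrite big_split /= [X in _ + X](reindex_inj (h := g)) ?addvv //.
exact: perm_inj.
Qed.

Lemma sum_addb_const (G : 'I_n -> fV) (F : 'I_n -> bool) (c : bool) :
  \sum_i G i = 0 -> \sum_i G i *+ (F i (+) c) = \sum_i G i *+ F i.
Proof.
move=> G0; under eq_bigr => i _ do rewrite mulrb_addb.
by rewrite big_split /= [X in _ + X]sumrMnl G0 mul0rn addr0.
Qed.

Lemma point_funM g h v : point_fun (g * h)%g v = point_fun h (point_fun g v).
Proof.
rewrite {2}/point_fun [X in _ = _ + X](reindex_inj (@perm_inj _ g)) /=.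
(* The pairing is equivariant on sums of two points only; on single points it shifts by this
   constant, which [sum_addb_const] absorbs because the coefficients sum to [0]. *)
pose c := linked (point_fun g v) (w (g k0)) (+) linked v (w k0).
have shift i : linked (point_fun g v) (w (g i)) = linked v (w i) (+) c.
  have := linked_point_fun g v i k0; rewrite !linkedDr /c.
  by case: (linked _ (w (g i))); case: (linked _ (w i)); case: (linked _ (w (g k0)));
    case: (linked _ (w k0)).
under [X in _ = _ + X]eq_bigr => i _ do rewrite shift.
rewrite sum_addb_const; last first.
  by rewrite -[RHS](sum_perm_add h) [RHS](reindex_inj (@perm_inj _ g)).
rewrite /point_fun -addrA; congr (_ + _).
rewrite -big_split /=; apply: eq_bigr => i _; rewrite -mulrnDl; congr (_ *+ _).
by rewrite permM addrC -addrA addKv addrC.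
Qed.

Lemma point_fun1 v : point_fun 1%g v = v.
Proof.
by rewrite /point_fun big1 ?addr0 // => i _; rewrite perm1 addvv mul0rn.
Qed.

Lemma point_funK g : cancel (point_fun g) (point_fun g^-1%g).
Proof. by move=> v; rewrite -point_funM mulgV point_fun1. Qed.

Definition point_perm g : {perm fV} := perm (can_inj (point_funK g)).

Lemma point_permM : {in [set: 'S_n] &, {morph point_perm : g h / (g * h)%g}}.
Proof. by move=> g h _ _; apply/permP => v; rewrite permM !permE point_funM. Qed.

Canonical point_morphism := Morphism point_permM.

Lemma point_perm_tperm i j :
  point_perm (tperm i j) = transv B (w i + w j).
Proof.
have [<- | ij] := eqVneq i j.
  apply/permP => v; rewrite permE tperm1 point_fun1 transvE addvv mul0rn.
  by rewrite addr0.
apply/permP => v; rewrite permE transvE /point_fun; congr (_ + _).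
rewrite (bigD1 i) //= (bigD1 j) 1?eq_sym //= tpermL tpermR big1 ?addr0.
  by rewrite [w j + _]addrC -mulrb_addb linkedDr.
by move=> k /andP[ki kj]; rewrite tpermD 1?eq_sym // addvv mul0rn.
Qed.

Hypothesis uniq_ends : forall i j k l,
  w i + w j = w k + w l -> i != j -> (i == k) || (i == l).
Hypothesis transv_neq1 : forall i j, i != j -> transv B (w i + w j) != 1%g.

Lemma sum_mulrb_pred1 (F : 'I_n -> fV) k : \sum_i F i *+ (k == i) = F k.
Proof.
rewrite (bigD1 k) //= eqxx big1 ?addr0 // => i; rewrite eq_sym => /negPf->.
exact: mulr0n.
Qed.

(** An element [g] of the kernel preserves every [w k + w l]. If it moves [k], all other points
    equal [g k], so [g] is the transposition of the only two points, and this acts as a nontrivial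
    transvection. *)
Lemma point_perm_inj : ('injm point_morphism)%g.
Proof.
apply/subsetP => g; rewrite !inE /= => /eqP g1.
have fix2 k l : w (g k) + w (g l) = w k + w l.
  have := congr1 (fun s : {perm fV} => s (w k + w l)) g1; rewrite /= permE perm1.
  rewrite /point_fun -[X in _ = X]addr0 => /addrI.
  have -> : \sum_i (w (g i) + w i) *+ linked (w k + w l) (w i) =
      \sum_i (w (g i) + w i) *+ ((k == i) (+) (l == i)).
    rewrite -[RHS](sum_addb_const _ (linked (w k + w l) (w k0) (+)
      (k == k0) (+) (l == k0)) (sum_perm_add g)).
    apply: eq_bigr => i _; congr (_ *+ nat_of_bool _).
    have := dotw k l i k0; rewrite linkedDr.
    by case: (linked _ _); case: (linked _ _); case: (k == i); case: (k == k0);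
      case: (l == i); case: (l == k0).
  under eq_bigr => i _ do rewrite mulrb_addb.
  rewrite big_split /= !sum_mulrb_pred1 addrACA => /eqP.
  by rewrite addv_eq0 => /eqP.
apply: contraT => g_neq1.
have [k gk] : exists k, g k != k.
  apply/existsP; apply: contraNT g_neq1; rewrite negb_exists => /forallP gE.
  by apply/eqP/permP => i; rewrite perm1; apply/eqP; move: (gE i); rewrite negbK.
have only m : m != k -> m = g k.
  move=> mk; have := uniq_ends (fix2 k m); rewrite (inj_eq perm_inj) eq_sym.
  by move=> /(_ mk); rewrite (negPf gk) => /eqP.
have eq_g : g = tperm k (g k).
  apply/permP => m; have [-> | mk] := eqVneq m k; first by rewrite tpermL.
  rewrite [in RHS](only m mk) tpermR; apply/eqP; apply: contraNT mk => /only.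
  by move/perm_inj->.
by have := transv_neq1 gk; rewrite addrC -point_perm_tperm -eq_g g1 eqxx.
Qed.

End PointAction.

(** * Isometries, conjugation of transvections, and the isomorphism *)

Definition isometries : {set {perm fV}} :=
  [set g : {perm fV} | [forall x, forall y,
    (g (x + y) == g x + g y) && (linked (g x) (g y) == linked x y)]].

Lemma isometriesP (g : {perm fV}) :
  reflect ((forall x y, g (x + y) = g x + g y) /\
           (forall x y, linked (g x) (g y) = linked x y))
          (g \in isometries).
Proof.
rewrite inE; apply: (iffP forallP) => [iso_g | [addg linkg] x].
  by split=> x y; have /forallP/(_ y)/andP[/eqP ? /eqP] := iso_g x.
by apply/forallP => y; rewrite addg linkg !eqxx.
Qed.

Lemma isometries_group_set : group_set isometries.
Proof.
apply/group_setP; split=> [|g h /isometriesP[addg linkg] /isometriesP[addh linkh]].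
  by apply/isometriesP; split=> x y; rewrite !perm1.
by apply/isometriesP; split=> x y; rewrite !permM ?addg ?linkh.
Qed.

Canonical isometries_group := Group isometries_group_set.

Lemma transv_isometry a : transv B a \in isometries.
Proof.
apply/isometriesP; split=> x y; rewrite !transvE.
  by rewrite linkedDl mulrb_addb addrACA.
rewrite linkedDl !linkedDr !linked_mulrb !(linkedC _ (_ *+ _)) !linked_mulrb.
rewrite linkedxx (linkedC y a) (linkedC a x) !andbF addbF.
by case: (linked x y); case: (linked x a); case: (linked a y).
Qed.

Lemma Tv_isometries S : Tv B S \subset isometries.
Proof.
by rewrite gen_subG; apply/subsetP => _ /imsetP[a _ ->]; apply: transv_isometry.
Qed.

Lemma transvJ a (g : {perm fV}) :
  g \in isometries -> (transv B a ^ g)%g = transv B (g a).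
Proof.
case/isometriesP=> addg linkg; apply/permP => x.
have g0 : g 0 = 0 by apply: (addrI (g 0)); rewrite -addg !addr0.
rewrite -[x](permKV g) permJ !transvE addg linkg; congr (_ + _).
by case: (linked _ a).
Qed.

Lemma transv0 : transv B 0 = 1%g.
Proof. by apply/permP => x; rewrite transvE perm1 mul0rn addr0. Qed.

Lemma transv_neq1 a b : linked a b -> transv B a != 1%g.
Proof.
move=> ab; apply/eqP => /(congr1 (fun g : {perm fV} => g b)).
rewrite transvE perm1 -[X in _ = X]addr0 => /addrI; rewrite linkedC ab.
by move=> a0; move: ab; rewrite -(mulr1n a) a0 linked0v.
Qed.

Lemma tree_points_isog S P :
    free (enum S) -> {in S, forall a, a \notin radical B} -> tree_points S P ->
  Tv B S \isog [set: 'S_#|P|].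
Proof.
move=> freeS radS treeP; have P0 := tree_point0 treeP.
pose w (i : 'I_#|P|) : fV := enum_val i.
have wP i : w i \in P by apply: enum_valP.
have w_inj : injective w := @enum_val_inj _ _.
pose k0 := enum_rank_in P0 0.
have wK : {in P, forall p, w (enum_rank_in P0 p) = p}.
  by move=> p pP; rewrite /w enum_rankK_in.
have dotw i j k l : linked (w i + w j) (w k + w l) =
    (i == k) (+) (i == l) (+) (j == k) (+) (j == l).
  by rewrite (tree_dot treeP) // !(inj_eq w_inj).
have uniq_ends i j k l : w i + w j = w k + w l -> i != j -> (i == k) || (i == l).
  rewrite -!(inj_eq w_inj); exact: (tree_uniq_ends freeS treeP).
(* A third point [k] gives [w j + w k], which is linked to [w i + w j]. With two points only,
   [w i + w j] is an element of [S], hence outside the radical. *)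
have transv_neq i j : i != j -> transv B (w i + w j) != 1%g.
  move=> ij; have [/existsP[k /andP[ki kj]] | only_ij] :=
      boolP [exists k, (k != i) && (k != j)].
    apply: (@transv_neq1 _ (w j + w k)); rewrite dotw eqxx.
    by rewrite (negPf ij) (eq_sym i) (negPf ki) (eq_sym j) (negPf kj).
  have inij k : (k == i) || (k == j).
    apply: contraNT only_ij; rewrite negb_or => kij.
    by apply/existsP; exists k.
  have /card_gt0P[a aS] : (0 < #|S|)%N.
    rewrite -ltnS -(tree_card treeP) (cardD1 (w i)) wP (cardD1 (w j)) !inE.
    by rewrite (inj_eq w_inj) eq_sym ij wP.
  have [p [q [pP qP def_a]]] := tree_edge treeP aS.
  have [b ab] := radicalPn (radS a aS); apply: (@transv_neq1 _ b).
  have := free_neq0 freeS aS; rewrite def_a in ab *.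
  rewrite -(wK p pP) -(wK q qP) in ab *.
  case/orP: (inij (enum_rank_in P0 p)) ab => /eqP->;
    case/orP: (inij (enum_rank_in P0 q)) => /eqP->; rewrite ?addvv ?eqxx //.
  by rewrite addrC.
have inj_rho := point_perm_inj k0 dotw uniq_ends transv_neq.
pose rho := point_morphism k0 dotw.
have rhoE i j : rho (tperm i j) = transv B (w i + w j).
  exact: point_perm_tperm.
suff -> : Tv B S = (rho @* [set: 'S_#|P|])%G.
  by rewrite isog_sym; apply: sub_isog.
apply/val_inj/eqP; rewrite eqEsubset; apply/andP; split.
  rewrite gen_subG; apply/subsetP => _ /imsetP[a aS ->].
  have [p [q [pP qP ->]]] := tree_edge treeP aS.
  by rewrite -(wK p pP) -(wK q qP) -rhoE mem_morphim ?inE.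
rewrite sub_morphim_pre ?subsetT //.
apply: (@subset_trans _ _ (mem <<[set tperm k0 k | k in 'I_#|P|]>>%g)).
  by rewrite gen_tperm.
rewrite gen_subG; apply/subsetP => _ /imsetP[k _ ->]; rewrite !inE /=.
rewrite -[point_perm _ _ _]/(rho (tperm k0 k)) rhoE wK // add0r.
(* The index [k0] stands for the point [0], so it remains to reach the transvection of every point.
   Along an edge [p + q] between distinct nonzero points, conjugation by its transvection carries
   that of [p] to that of [q]. *)
pose X := [set p in P | transv B p \in Tv B S].
suff /subsetP/(_ _ (wP k)) : P \subset X by rewrite inE => /andP[].
apply: (tree_connected treeP) => [|p q pP qP pqS].
  by rewrite inE P0 transv0 group1.
have tpq : transv B (p + q) \in Tv B S by apply/mem_gen/imset_f.
rewrite !inE pP qP /= => tp.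
have [-> | p0] := eqVneq q 0; first by rewrite transv0 group1.
have [<- // | pq] := eqVneq p q.
have [p_0 | p_neq0] := eqVneq p 0; first by move: tpq; rewrite p_0 add0r.
have <- : transv B (p + q) p = q.
  rewrite transvE linkedDr linkedxx (tree_form treeP) // (negPf p_neq0).
  by rewrite (negPf p0) (negPf pq) addKv.
by rewrite -transvJ ?transv_isometry // groupJ.
Qed.

End Form.

(** * Groups of transvections isomorphic to symmetric groups *)

Section TransvectionRelations.
Variables (V : vectType 'F_2) (B : symplectic_form V).
Local Notation fV := (finvect_type V).
Implicit Types (a b c x y : fV) (S : {set fV}).

Lemma transv2 a : (transv B a * transv B a = 1)%g.
Proof. by apply/permP => x; rewrite permM perm1 !permE transv_funK. Qed.

Lemma transv_conj a b :
  (transv B a ^ transv B b)%g = transv B (a + b *+ linked B a b).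
Proof. by rewrite transvJ ?transv_isometry // transvE. Qed.

Lemma transv_inj a b c : linked B a c -> transv B a = transv B b -> a = b.
Proof.
move=> ac /(congr1 (fun g : {perm fV} => g c)); rewrite !transvE => /addrI.
rewrite linkedC ac; case: (linked B c b) => //= a0.
by move: ac; rewrite -(mulr1n a) a0 linked0v.
Qed.

Lemma transv_conj_eq a b :
  ((transv B a ^ transv B b)%g == transv B a) = ~~ linked B a b.
Proof.
rewrite transv_conj; case ab: (linked B a b); last by rewrite addr0 eqxx.
apply/eqP => /(@transv_inj _ _ b).
rewrite linkedDl linkedxx addbF => /(_ ab)/eqP; rewrite -subr_eq0 addrAC subrr add0r.
by move=> /eqP b0; move: ab; rewrite -(mulr1n b) b0 linkedv0.
Qed.

(** If [a] and [b] are linked, each transvection conjugates the other to that of [a + b], which is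
    the braid relation; otherwise they commute. *)
Lemma transv_mul_order a b :
  ((transv B a * transv B b) ^+ 2 = 1)%g \/ ((transv B a * transv B b) ^+ 3 = 1)%g.
Proof.
have ea := transv2 a; have eb := transv2 b.
have Va : (transv B a)^-1%g = transv B a.
  by apply: (mulgI (transv B a)); rewrite mulgV ea.
have Vb : (transv B b)^-1%g = transv B b.
  by apply: (mulgI (transv B b)); rewrite mulgV eb.
have cab := transv_conj a b; have cba := transv_conj b a.
rewrite !expgS expg0 !mulg1; move: cab cba; rewrite !conjgE Va Vb (linkedC B b a).
set s := transv B a in ea *; set t := transv B b in eb *.
case ab: (linked B a b) => /= cab cba; [right | left].
  have tst : (t * (s * t) = s * (t * s))%g by rewrite cab cba addrC.
  rewrite -!mulgA tst !mulgA -[(_ * s * s)%g]mulgA ea mulg1.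
  by rewrite -[(_ * t * t)%g]mulgA eb mulg1.
by rewrite -mulgA cab addr0.
Qed.

End TransvectionRelations.

(** * Properties of the graph forced by a labelling *)

Section Labelled.
Variables (V : vectType 'F_2) (B : symplectic_form V).
Local Notation fV := (finvect_type V).
Variables (S : {set fV}) (gT : finGroupType) (f : {morphism Tv B S >-> gT}).
Variables (F : finType) (C : {set gT}) (lab : gT -> {set F}).
Hypotheses (freeS : free (enum S)).
Hypotheses (radS : {in S, forall a, a \notin radical B}).
Hypotheses (inj_f : ('injm f)%g) (onto_f : (f @* Tv B S)%g = [set: gT]).
Hypotheses (labC : labelling C lab).
Hypothesis SC : {in S, forall a, f (transv B a) \in C}.
Implicit Types (a b c d x y : fV).

(** Larger than [S] in general: it contains the sums of linked elements ([linked_add]), formed along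
    a path. *)
Let D := [set x : fV | (transv B x \in Tv B S) && (f (transv B x) \in C)].
Let label x := lab (f (transv B x)).

Lemma transv_Tv a : a \in S -> transv B a \in Tv B S.
Proof. by move=> aS; apply/mem_gen/imset_f. Qed.

Let SD a : a \in S -> a \in D.
Proof. by move=> aS; rewrite inE transv_Tv ?SC. Qed.

Let card_label x : x \in D -> #|label x| = 2.
Proof. by rewrite inE => /andP[_ xC]; apply: (label_card labC). Qed.

Let inj_label a x : a \in S -> x \in D -> label a = label x -> a = x.
Proof.
move=> aS xD; have aD := SD aS; have [b ab] := radicalPn (radS aS).
move: xD aD; rewrite !inE => /andP[xT xC] /andP[aT aC].
by move=> /(label_inj labC aC xC)/(injmP inj_f _ _ aT xT); apply: transv_inj ab.
Qed.

Let linkedE x y : x \in D -> y \in D ->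
  linked B x y = (#|label x :&: label y| == 1)%N.
Proof.
rewrite !inE => /andP[xT xC] /andP[yT yC].
apply: negb_inj; rewrite -transv_conj_eq -(label_commute labC) //.
by rewrite -morphJ // (inj_in_eq (injmP inj_f)) ?groupJ.
Qed.

(** The transvection of [x + y] is the conjugate of that of [x] by that of [y]. *)
Let linked_add x y : x \in D -> y \in D -> linked B x y ->
  x + y \in D /\ label (x + y) = symdiff (label x) (label y).
Proof.
move=> xD yD xy; have := xy; rewrite linkedE // => /eqP card_xy.
move: xD yD; rewrite !inE => /andP[xT xC] /andP[yT yC].
have := transv_conj B x y; rewrite xy mulr1n => conj_xy.
rewrite /label -conj_xy groupJ ?morphJ // (label_conj labC) //.
by rewrite (label_symdiff labC).
Qed.

(** Three pairs each meeting a given pair: two of them meet it at the same point. *)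
Lemma labelled_claw_free : claw_free (form_graph B S).
Proof.
apply/claw_freeP => z x1 x2 x3; rewrite !form_graphE.
move=> /and3P[zS x1S zx1] /and3P[_ x2S zx2] /and3P[_ x3S zx3] n12 n13 n23.
rewrite x1S x2S x3S /=.
have meet x y u : x \in S -> y \in S -> x != y -> u \in label x ->
    u \in label y -> linked B x y.
  move=> xS yS xy ux uy; rewrite linkedE ?SD //; apply/eqP.
  apply: (@cardsI1 _ _ _ u); rewrite ?card_label ?SD //.
  by apply: contraNneq xy => /inj_label->; rewrite ?SD.
have ends x : x \in S -> linked B z x -> exists2 u, u \in label z & u \in label x.
  move=> xS; rewrite linkedE ?SD // => /cards1P[u eq_u].
  by have := set11 u; rewrite -eq_u => /setIP[]; exists u.
have [u1 z1 u1x] := ends x1 x1S zx1; have [u2 z2 u2x] := ends x2 x2S zx2.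
have [u3 z3 u3x] := ends x3 x3S zx3.
have [e12 | u12] := eqVneq u1 u2; first by rewrite (meet x1 x2 u1) // e12.
have [e13 | u13] := eqVneq u1 u3; first by rewrite (meet x1 x3 u1) ?orbT // e13.
have [e23 | u23] := eqVneq u2 u3; first by rewrite (meet x2 x3 u2) ?orbT // e23.
move: z3; rewrite (pair_set (card_label (SD zS)) z1 z2 u12) !inE.
by rewrite eq_sym (negPf u13) eq_sym (negPf u23).
Qed.

(** Labels are edges of a complete graph; adding suitable members of the path yields the chord from
    [u] to [w], still in the span of [S :\ a]. *)
Let path_label a b p u w : a \in S -> b \in S -> b != a ->
    path (del_adj (form_graph B S) a) b p ->
    u \in label b -> w \in label (last b p) -> u != w ->
  exists d, [/\ d \in D, d \in <<enum (S :\ a)>>%VS & label d = [set u; w]].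
Proof.
move=> aS bS ba; elim/last_ind: p w => [|p y IHp] w /=.
  move=> _ ub wb uw; exists b; split; first exact: SD.
    by rewrite memv_span // mem_enum !inE ba.
  by rewrite (pair_set (card_label (SD bS)) ub wb uw).
rewrite rcons_path last_rcons; set x := last b p => /andP[bp].
case/and3P=> xa ya /and3P[xS yS xy] ub wy uw.
have yspan : y \in <<enum (S :\ a)>>%VS by rewrite memv_span // mem_enum !inE ya.
have := linkedE (SD xS) (SD yS); rewrite (xy : linked B x y) => /esym/cards1P[v xyv].
have /setIP[vx vy] : v \in label x :&: label y by rewrite xyv set11.
have [wv | wv] := eqVneq w v; first by apply: IHp; rewrite ?wv // -wv.
have label_y := pair_set (card_label (SD yS)) wy vy wv.
have [uv | uv] := eqVneq u v.
  by exists y; rewrite uv setUC; split=> //; exact: SD.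
have [d [dD dspan label_d]] := IHp v bp ub vx uv.
have dy : linked B d y.
  rewrite (linkedE dD (SD yS)) (@cardsI1 _ _ _ v) ?(card_label dD)
    ?(card_label (SD yS)) //.
  - rewrite label_d label_y; apply: contraNneq uw => /setP/(_ u).
    by rewrite !inE eqxx (negPf uv) !orbF => /esym.
  - by rewrite label_d !inE eqxx orbT.
have [dyD label_dy] := linked_add dD (SD yS) dy.
exists (d + y); rewrite rpredD // label_dy label_d label_y; split=> //.
apply/setP => z; rewrite in_symdiff !inE.
have [-> | zu] := eqVneq z u; first by rewrite (negPf uw) (negPf uv).
have [-> | zw] := eqVneq z w; first by rewrite (negPf wv).
by rewrite /= addbb.
Qed.

Lemma labelled_cycle_closed : cycle_closed (form_graph B S).
Proof.
move=> a b c; rewrite !form_graphE => /and3P[aS bS ab] /and3P[_ cS ac] bc.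
case/connectP=> p bp c_last; rewrite bS cS /= linkedE ?SD //.
have nlab x y : x \in S -> y \in S -> x != y -> label x != label y.
  by move=> xS yS; apply: contraNneq => /inj_label->; rewrite ?SD.
have ends x : x \in S -> linked B a x -> exists2 u, u \in label a & u \in label x.
  move=> xS; rewrite linkedE ?SD // => /cards1P[u eq_u].
  by have := set11 u; rewrite -eq_u => /setIP[]; exists u.
have [u ua ub] := ends b bS ab; have [w wa wc] := ends c cS ac.
have [uw | uw] := eqVneq u w.
  by rewrite (@cardsI1 _ _ _ u) ?card_label ?nlab ?SD // uw.
have ba : b != a by rewrite eq_sym; apply: linked_neq ab.
have wc' : w \in label (last b p) by rewrite -c_last.
have [d [dD dspan label_d]] := path_label aS bS ba bp ub wc' uw.
have ad : a = d.
  by apply: inj_label; rewrite // label_d; apply: pair_set; rewrite ?card_label ?SD.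
by have := free_notin_span freeS aS; rewrite [X in X \notin _]ad dspan.
Qed.

(** If [K] is the component of [a] and [b] lies outside it, [Tv K] is normal in [Tv S] and
    centralized by the transvection of [b], which thus commutes with all conjugates of that of [a],
    against [label_noncommuting]. *)
Lemma labelled_connected : connected (form_graph B S).
Proof.
move=> a b aS bS; apply: contraT => nab.
pose G := form_graph B S; pose K := [set c in S | connect (adj G) a c].
have sKS : K \subset S by apply/subsetP => c; rewrite inE => /andP[].
have sepK c d : c \in K -> d \in S -> d \notin K -> linked B c d = false.
  rewrite inE => /andP[cS ac] dS; apply: contraNF => cd; rewrite inE dS.
  by apply: connect_trans ac _; apply/connect1/and3P.
have centK d : d \in S -> d \notin K -> transv B d \in 'C(Tv B K)%g.
  move=> dS dK; rewrite cent_gen; apply/centP => _ /imsetP[c cK ->].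
  apply/commgP/conjg_fixP/eqP; rewrite transv_conj_eq linkedC.
  by rewrite sepK.
have normK : (Tv B S \subset 'N(Tv B K))%g.
  rewrite gen_subG; apply/subsetP => _ /imsetP[d dS ->].
  have [dK | dK] := boolP (d \in K); last exact/(subsetP (cent_sub _))/centK.
  by apply: (subsetP (normG _)); apply/mem_gen/imset_f.
have bK : b \notin K by rewrite inE bS.
have aK : a \in K by rewrite inE aS /=.
have fab : f (transv B a) != f (transv B b).
  apply: contraNneq bK => eq_fab.
  have [c ac] := radicalPn (radS aS).
  have eq_t := injmP inj_f _ _ (transv_Tv aS) (transv_Tv bS) eq_fab.
  by rewrite -(transv_inj ac eq_t).
have [g /eqP[]] := label_noncommuting labC (SC aS) (SC bS) fab.
have : g \in (f @* Tv B S)%g by rewrite onto_f inE.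
case/morphimP=> h hT _ ->; rewrite -!morphJ ?groupJ ?transv_Tv //; congr (f _).
apply/conjg_fixP/commgP/(centP (centK b bS bK)).
by rewrite memJ_norm ?(subsetP normK) //; apply/mem_gen/imset_f.
Qed.

End Labelled.

(** * Images of transvections in a symmetric group *)

Section SymmetricTv.
Variables (V : vectType 'F_2) (B : symplectic_form V).
Local Notation fV := (finvect_type V).
Variables (S : {set fV}) (n : nat) (f : {morphism Tv B S >-> 'S_n}).
Hypotheses (radS : {in S, forall a, a \notin radical B}).
Hypotheses (inj_f : ('injm f)%g) (onto_f : (f @* Tv B S)%g = [set: 'S_n]).
Implicit Types (a b : fV).

Lemma image_transv_involutive a : a \in S -> involutive (f (transv B a)).
Proof.
move=> aS i; rewrite -permM -morphM ?transv_Tv // transv2 morph1.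
exact: perm1.
Qed.

Lemma image_transv_neq1 a : a \in S -> f (transv B a) != 1%g.
Proof.
move=> aS; have [b ab] := radicalPn (radS aS).
by rewrite morph_injm_eq1 ?transv_Tv // (transv_neq1 ab).
Qed.

Lemma image_transv_short a b : a \in S -> b \in S ->
  short_products (f (transv B a)) (f (transv B b)).
Proof.
move=> aS bS g; have : g \in (f @* Tv B S)%g by rewrite onto_f inE.
case/morphimP=> h hT _ ->; have aT := transv_Tv B aS; have bT := transv_Tv B bS.
have bhT := groupJ bT hT; have abT := groupM aT bhT.
rewrite -morphJ // -morphM // -!morphX //.
rewrite transvJ ?(subsetP (Tv_isometries B S)) //.
by case: (transv_mul_order B a (h b)) => ->; rewrite morph1; auto.
Qed.

(** If [a] were linked to [b], the transvections of [a] and [a + b] would be conjugate and not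
    commute, unlike fixed point free involutions of degree 4. So that of [a] is central, while
    ['S_4] has trivial center. *)
Lemma image_transv_not4 a : a \in S -> n = 4 ->
  f (transv B a) \in fpf_involutions n -> False.
Proof.
move=> aS n4; have aT := transv_Tv B aS; set t := f (transv B a) => tC.
have tJ s : s \in fpf_involutions n -> (t ^ s = t)%g.
  move: t tC s; rewrite {}n4 => t tC s; exact: fpf_involutions4_commute.
have nolink b : b \in S -> linked B a b = false.
  move=> bS; apply/negbTE; have bT := transv_Tv B bS.
  apply/negP => ab.
  have := tJ _ (fpf_involutionJ tC (f (transv B b))).
  rewrite -!morphJ ?groupJ // => /(injmP inj_f _ _ (groupJ aT (groupJ aT bT)) aT).
  move/eqP; rewrite (transv_conj B a b) ab mulr1n transv_conj_eq linkedDr.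
  by rewrite linkedxx ab.
have central h : h \in Tv B S -> (transv B a ^ h)%g = transv B a.
  have centa : transv B a \in 'C(Tv B S)%g.
    rewrite cent_gen; apply/centP => _ /imsetP[b bS ->].
    by apply/commgP/conjg_fixP/eqP; rewrite transv_conj_eq nolink.
  by move=> hT; apply/conjg_fixP/commgP/(centP centa).
have tJT g : (t ^ g)%g = t.
  have : g \in (f @* Tv B S)%g by rewrite onto_f inE.
  by case/morphimP=> h hT _ ->; rewrite -morphJ // central.
have [tt fpf] := fpf_involutionP _ tC.
have n3 : (2 < #|'I_n|)%N by rewrite card_ord n4.
have [x _] : exists x : 'I_n, x \in 'I_n by apply/card_gt0P; rewrite (leq_trans _ n3).
have [y yx ytx] : exists2 y, y != x & y != t x.
  have : ~~ ([set: 'I_n] \subset [set x; t x]).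
    apply/negP => /subset_leq_card; rewrite cardsT leqNgt => /negP[].
    by apply: leq_ltn_trans n3; rewrite cards2; case: (x != t x).
  by case/subsetPn=> y _; rewrite !inE negb_or => /andP[]; exists y.
have fix_x : tperm (t x) y x = x by rewrite tpermD // fpf.
have : (t ^ tperm (t x) y)%g (tperm (t x) y x) = y by rewrite permJ tpermL.
by rewrite tJT fix_x => def_y; rewrite def_y eqxx in ytx.
Qed.

Lemma symmetric_Tv_graph : free (enum S) ->
  [/\ connected (form_graph B S), claw_free (form_graph B S) &
      cycle_closed (form_graph B S)].
Proof.
move=> freeS.
have split_S a : a \in S -> f (transv B a) \in transpositions _ \/
    n = 6 /\ f (transv B a) \in fpf_involutions n.
  move=> aS; have tt := image_transv_involutive aS.
  have [[x [y xy]] | [fpf]] :=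
    short_products_cases tt (image_transv_neq1 aS) (image_transv_short aS aS).
    by left; apply/transpositionsP; exists x, y.
  have tC : f (transv B a) \in fpf_involutions n by apply/fpf_involutionP.
  by rewrite card_ord => -[n4 | n6]; [have [] := image_transv_not4 aS n4 | right].
have conclude (F : finType) C (lab : 'S_n -> {set F}) : labelling C lab ->
    {in S, forall a, f (transv B a) \in C} ->
    [/\ connected (form_graph B S), claw_free (form_graph B S) &
      cycle_closed (form_graph B S)].
  move=> labC SC; split.
  - exact: labelled_connected labC SC.
  - exact: labelled_claw_free labC SC.
  - exact: labelled_cycle_closed labC SC.
have [/forall_inP all_tr | ] :=
    boolP [forall a in S, f (transv B a) \in transpositions _].
  exact: conclude (transposition_labelling _) all_tr.
rewrite negb_forall => /existsP[a]; rewrite negb_imply => /andP[aS nt].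
have [ta | [n6 aC]] := split_S a aS; first by rewrite ta in nt.
(* The two types cannot coexist: by [short_products_tperm], a fixed point free image and a
   transposition have conjugates with a product of too large order. *)
have all_fpf : {in S, forall b, f (transv B b) \in fpf_involutions n}.
  move=> b bS; have [/transpositionsP[y [z [yz def_b]]] | [] //] := split_S b bS.
  have [tt fpf] := fpf_involutionP _ aC.
  have := image_transv_short aS bS; rewrite def_b => short_ab.
  have n2 : (2 < n)%N by rewrite n6.
  pose x1 : 'I_n := Ordinal (ltnW (ltnW n2)).
  have [clos2 uniq2] :=
    uniq_add_pair tt (xs := [::]) (x := x1) (fun _ => id) isT isT (fpf x1).
  have /subsetPn[x3 _ n3] : ~~ ([set: 'I_n] \subset [:: x1; f (transv B a) x1]).
    apply/negP => /subset_leq_card; rewrite cardsT card_ord.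
    by move=> /leq_trans/(_ (card_size _)); rewrite leqNgt n2.
  have [_ uniq4] := uniq_add_pair tt clos2 uniq2 n3 (fpf x3).
  by case: (short_products_tperm tt uniq4 yz).
move: f inj_f onto_f all_fpf conclude {aC nt split_S}; rewrite n6 => f' _ _ all_fpf.
by apply; [exact: syntheme_labelling | exact: all_fpf].
Qed.

End SymmetricTv.

Theorem theorem3p1 (V : vectType 'F_2) (dimV : (0 < \dim {:V})%N)
    (B : symplectic_form V) (S : {set finvect_type V})
    (S_free : free (enum S))
    (S_rad : forall a : finvect_type V, a \in S -> a \notin radical B) :
  (exists n : nat, Tv B S \isog [set: 'S_n]) <->
  (claw_free (form_graph B S) /\ block_graph (form_graph B S)).
Proof.
split=> [[n /isogP[f inj_f onto_f]] | [clawS blockS]].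
  have [conS clawS cycS] := symmetric_Tv_graph S_rad inj_f onto_f S_free.
  by split=> //; apply: cycle_closed_block_graph.
have cycS := block_graph_cycle_closed blockS.
have [P treeP] := exists_tree_points S_free blockS.1 clawS cycS.
by exists #|P|; apply: tree_points_isog.
Qed.
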